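(* Let $\gamma=\frac{2}{\epsilon}+\frac{2\omega\lambda\pi}{\epsilon_1^2}$, where $\omega$ is the number of channels of the image and $\epsilon_1=\frac{1}{2p}$ with $p$ a positive odd number. Under the condition $S\ge\frac{\gamma}{2}$ on the stabilizer $S$, the alternating direction minimization iteration described in the context, with either the ETD1 or the ETDRK2 scheme, is unconditionally (that is, for every time step $\Delta t>0$) energy stable: for every $k\ge0$, $$E_h(\mathbf U^{k+1},\mathbf C^{k+1})\le E_h(\mathbf U^{k},\mathbf C^{k}).$$
   Context: Four-phase image segmentation with two phase variables. The image $I$ has $M_1\times M_2$ pixels and $\omega$ channels, and $I_\ell(r)$ is its value at pixel $\ell\in\{1,\dots,M_1M_2\}$ in channel $r$. The average intensities are $\mathbf C=(\mathbf C_{11},\mathbf C_{12},\mathbf C_{21},\mathbf C_{22})$, where $\mathbf C_{ab}(r)$ is a constant (independent of the pixel) for each channel $r$. Image values and average intensities are scaled to $[0,1]$. The phase variables are $\mathbf U=(U_1,U_2)$, $U_i=[U_{i,\ell}]_{\ell=1}^{M_1M_2}\in\mathbb R^{M_1M_2}$, and the initial phase variables $\mathbf U^0$ have entries in $[0,1]$. The parameters $\epsilon,\lambda,h,S,\Delta t$ are positive ($h$ is the spatial step), and $\epsilon_1<\frac12$. Regularized Heaviside function: $H_{\epsilon_1}(u)=\frac{1}{2\epsilon_1}\left(u+\frac{\epsilon_1}{\pi}\sin\frac{\pi u}{\epsilon_1}\right)+\frac12$ for $|u|\le\epsilon_1$, $H_{\epsilon_1}(u)=1$ for $u>\epsilon_1$,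 $H_{\epsilon_1}(u)=0$ for $u<-\epsilon_1$. Its derivative is $\delta_{\epsilon_1}(u)=\frac{1}{2\epsilon_1}\left(1+\cos\frac{\pi u}{\epsilon_1}\right)$ for $|u|\le\epsilon_1$ and $0$ for $|u|>\epsilon_1$. Let $W(u)=u^2(u-1)^2$ and $w(u)=W'(u)=2u(2u-1)(u-1)$. Pixelwise write $A_{ab}(r)=(I(r)-\mathbf C_{ab}(r))^2$ and $h_i=H_{\epsilon_1}(u_i-\frac12)$, and define $$F_{\epsilon_1}(u_1,u_2,I)=\lambda\sum_{r=1}^{\omega}\big[A_{11}(r)h_1h_2+A_{12}(r)h_1(1-h_2)+A_{21}(r)(1-h_1)h_2+A_{22}(r)(1-h_1)(1-h_2)\big],$$ $$f_1(u_1,u_2,\mathbf C)=\lambda\sum_{r=1}^{\omega}\big\{[A_{11}(r)-A_{21}(r)]h_2+[A_{12}(r)-A_{22}(r)](1-h_2)\big\}\delta_{\epsilon_1}(u_1-\tfrac12),$$ $$f_2(u_1,u_2,\mathbf C)=\lambda\sum_{r=1}^{\omega}\big\{[A_{11}(r)-A_{12}(r)]h_1+[A_{21}(r)-A_{22}(r)](1-h_1)\big\}\delta_{\epsilon_1}(u_2-\tfrac12).$$ Let $D_h=\frac1{h^2}(I_{M_2}\otimes\Lambda_{M_1}+\Lambda_{M_2}\otimes I_{M_1})$, where $I_M$ is the $M\times M$ identity matrix and $\Lambda_M$ is the $M\times M$ tridiagonal matrix with off-diagonal entries $1$ and diagonal entries $-1,-2,\dots,-2,-1$ (discrete Laplacian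 with homogeneous Neumann boundary condition). The discrete energy is $$E_h(\mathbf U,\mathbf C)=\sum_{\ell=1}^{M_1M_2}\Big(\sum_{i=1}^2\frac1\epsilon W(U_{i,\ell})+F_{\epsilon_1}(U_{1,\ell},U_{2,\ell},I_\ell)\Big)-\sum_{i=1}^2\epsilon\,U_i^TD_hU_i.$$ For fixed $\mathbf C$, the spatially discretized Allen–Cahn equations are $\frac{dU_i}{dt}+L_hU_i=N(U_i)$, $i=1,2$, with $L_h=-2\epsilon D_h+S\,I_d$ ($I_d$ the identity matrix of size $M_1M_2$, $S>0$ the stabilizer) and $N(U_i)=SU_i-\frac1\epsilon w(U_i)-f_i(U_1,U_2,\mathbf C)$ entrywise. Put $\phi_0(a)=e^{-a}$, $\phi_1(a)=\frac{1-e^{-a}}{a}$, $\phi_2(a)=\frac{e^{-a}-1+a}{a^2}$, applied to matrices. The time-stepping schemes with time step $\Delta t$ (time level $n$) are, for $i=1,2$: ETD1: $U_i^{n+1}=\phi_0(L_h\Delta t)U_i^n+\Delta t\,\phi_1(L_h\Delta t)N(U_i^n)$. ETDRK2: $\hat U_i^{n+1}=\phi_0(L_h\Delta t)U_i^n+\Delta t\,\phi_1(L_h\Delta t)N(U_i^n)$, then $U_i^{n+1}=\hat U_i^{n+1}+\Delta t\,\phi_2(L_h\Delta t)\big(N(\hat U_i^{n+1})-N(U_i^n)\big)$. Alternating direction minimization iteration (outer index $k$): given $(\mathbf U^k,\mathbf C^k)$, (1) the minimization of the energy in the phase variables with $\mathbf C=\mathbf C^k$ fixed is carried out by running the chosen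 scheme (ETD1 or ETDRK2) from $\mathbf U^k$ until a steady state, which is taken as $\mathbf U^{k+1}$; (2) $\mathbf C^{k+1}$ minimizes $\mathbf C\mapsto E_h(\mathbf U^{k+1},\mathbf C)$; that is, for all $a,b\in\{1,2\}$ and each $r$, $\mathbf C_{ab}^{k+1}(r)$ is the weighted average of $I(r)$ over the pixels, $\frac{\sum_\ell\chi_{ab,\ell}I_\ell(r)}{\sum_\ell\chi_{ab,\ell}}$, with weights $\chi_{11}=h_1h_2$, $\chi_{12}=h_1(1-h_2)$, $\chi_{21}=(1-h_1)h_2$, $\chi_{22}=(1-h_1)(1-h_2)$ evaluated at $\mathbf U^{k+1}$. *)

(* Defs.v *)
From HB Require Import structures.
From mathcomp Require Import all_boot all_order all_algebra.
From mathcomp Require Import all_classical all_reals all_analysis.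
From mathcomp.real_closed Require Export mxtens.

Set Implicit Arguments.
Unset Strict Implicit.
Unset Printing Implicit Defensive.

Import Order.TTheory GRing.Theory Num.Theory.
Import numFieldNormedType.Exports.
Local Open Scope classical_set_scope.
Local Open Scope ring_scope.

Section ScalarFunctions.
Variable R : realType.
Implicit Types u a : R.

Definition heaviside (eps1 u : R) : R :=
  if `|u| <= eps1 then
    (2 * eps1)^-1 * (u + eps1 / pi * sin (pi * u / eps1)) + 2^-1
  else if eps1 < u then 1 else 0.

Definition delta (eps1 u : R) : R :=
  if `|u| <= eps1 then (2 * eps1)^-1 * (1 + cos (pi * u / eps1)) else 0.

Definition dwell u : R := u ^+ 2 * (u - 1) ^+ 2.
Definition dwell' u : R := 2 * u * (2 * u - 1) * (u - 1).

Definition phi0 a : R := expR (- a).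
Definition phi1 a : R := (1 - expR (- a)) / a.
Definition phi2 a : R := (expR (- a) - 1 + a) / a ^+ 2.

End ScalarFunctions.

(* The matrix f(A) of a diagonalizable real matrix A: f acts on the
   eigenvalues. The result does not depend on the diagonalization chosen. It is
   only used for the symmetric matrix Lh * dt, whose eigenvalues are positive,
   so the value of phi1 and phi2 at 0 is irrelevant. *)
Definition mxfun (R : realType) (n : nat) (f : R -> R) (A : 'M[R]_n) : 'M[R]_n :=
  xget 0 [set B | exists (P : 'M[R]_n) (d : 'rV[R]_n),
    [/\ P \in unitmx, A = invmx P *m diag_mx d *m P
      & B = invmx P *m diag_mx (map_mx f d) *m P]].

Section Discretization.
Variable R : realType.

(* 1-D Neumann Laplacian. The diagonal entry is minus the number of neighbours,
   i.e. -1, -2, ..., -2, -1 for M >= 2 (and 0 for M = 1). *)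
Definition Lambda (M : nat) : 'M[R]_M :=
  \matrix_(i, j)
    if i == j then - ((0 < i)%N%:R + (i.+1 < M)%N%:R)
    else if (i.+1 == j :> nat) || (j.+1 == i :> nat) then 1 else 0.

Definition Dh (M1 M2 : nat) (h : R) : 'M[R]_(M2 * M1) :=
  (h ^+ 2)^-1 *: (1%:M *t Lambda M1 + Lambda M2 *t 1%:M).

Definition Lh (M1 M2 : nat) (eps h S : R) : 'M[R]_(M2 * M1) :=
  - (2 * eps) *: Dh M1 M2 h + S%:M.

End Discretization.

(* The phases 1, 2 are the indices 0, 1 of 'I_2: C 0 1 r is C_12(r). *)
Definition intensities (R : realType) (om : nat) := 'I_2 -> 'I_2 -> 'I_om -> R.

Definition phases (R : realType) (M1 M2 : nat) :=
  ('cV[R]_(M2 * M1) * 'cV[R]_(M2 * M1))%type.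

Section Model.
Variables (R : realType) (M1 M2 om : nat).
Variables (eps lam eps1 h S dt : R).
Variable img : 'I_(M2 * M1) -> 'I_om -> R.

Local Notation intensities := (intensities R om).
Local Notation phases := (phases R M1 M2).
Local Notation H u := (heaviside eps1 (u - 2^-1)).

Definition fidelity (px : 'I_om -> R) (C : intensities) (a b : 'I_2)
  (r : 'I_om) : R := (px r - C a b r) ^+ 2.

Definition F (u1 u2 : R) (px : 'I_om -> R) (C : intensities) : R :=
  let A := fidelity px C in
  lam * \sum_(r < om)
    (A 0 0 r * H u1 * H u2 + A 0 1 r * H u1 * (1 - H u2)
     + A 1 0 r * (1 - H u1) * H u2 + A 1 1 r * (1 - H u1) * (1 - H u2)).

Definition f1 (u1 u2 : R) (px : 'I_om -> R) (C : intensities) : R :=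
  let A := fidelity px C in
  lam * \sum_(r < om)
    (((A 0 0 r - A 1 0 r) * H u2 + (A 0 1 r - A 1 1 r) * (1 - H u2))
     * delta eps1 (u1 - 2^-1)).

Definition f2 (u1 u2 : R) (px : 'I_om -> R) (C : intensities) : R :=
  let A := fidelity px C in
  lam * \sum_(r < om)
    (((A 0 0 r - A 0 1 r) * H u1 + (A 1 0 r - A 1 1 r) * (1 - H u1))
     * delta eps1 (u2 - 2^-1)).

Definition energy (U : phases) (C : intensities) : R :=
  \sum_(l < M2 * M1)
     (eps^-1 * dwell (U.1 l 0) + eps^-1 * dwell (U.2 l 0)
      + F (U.1 l 0) (U.2 l 0) (img l) C)
  - (eps * (U.1^T *m Dh M1 M2 h *m U.1) 0 0
     + eps * (U.2^T *m Dh M1 M2 h *m U.2) 0 0).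

Definition nonlin (U : phases) (C : intensities) : phases :=
  (\col_l (S * U.1 l 0 - eps^-1 * dwell' (U.1 l 0)
           - f1 (U.1 l 0) (U.2 l 0) (img l) C),
   \col_l (S * U.2 l 0 - eps^-1 * dwell' (U.2 l 0)
           - f2 (U.1 l 0) (U.2 l 0) (img l) C)).

Definition etd_op (phi : R -> R) (U : phases) : phases :=
  let B := mxfun phi (dt *: Lh M1 M2 eps h S) in (B *m U.1, B *m U.2).

Definition etd1_step (C : intensities) (U : phases) : phases :=
  etd_op (@phi0 R) U + dt *: etd_op (@phi1 R) (nonlin U C).

Definition etdrk2_step (C : intensities) (U : phases) : phases :=
  let Uhat := etd1_step C U in
  Uhat + dt *: etd_op (@phi2 R) (nonlin Uhat C - nonlin U C).

Inductive scheme := ETD1 | ETDRK2.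

Definition scheme_step (s : scheme) : intensities -> phases -> phases :=
  match s with ETD1 => etd1_step | ETDRK2 => etdrk2_step end.

Definition reaches_steady_state (step : phases -> phases) (U V : phases) :=
  step V = V /\ (fun n => iter n step U) @ \oo --> V.

Definition weight (a b : 'I_2) (U : phases) (l : 'I_(M2 * M1)) : R :=
  (if a == 0 then H (U.1 l 0) else 1 - H (U.1 l 0))
  * (if b == 0 then H (U.2 l 0) else 1 - H (U.2 l 0)).

(* When the total weight of phase (a, b) is 0, the energy does not depend on
   C a b, which is then left unconstrained. *)
Definition is_average_intensity (U : phases) (C : intensities) :=
  forall a b r, \sum_l weight a b U l != 0 ->
    C a b r = (\sum_l weight a b U l * img l r) / \sum_l weight a b U l.

Definition adm_iteration (s : scheme) (U : nat -> phases)
    (C : nat -> intensities) :=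
  forall k, reaches_steady_state (scheme_step s (C k)) (U k) (U k.+1)
         /\ is_average_intensity (U k.+1) (C k.+1).

End Model.

(* Main.v *)
(** Centre the phases at 1/2, and say that a vector overshoots where it leaves
    [0, 1].  The maximum principle fails on [0, 1] when [S < 2 / eps], but the
    linear flow behind the schemes keeps the iterates within distance 49/90 of
    1/2.  Write [L = D + S], [D = - 2 eps Dh], and let [V] be an ETD1 step from
    [U].  The residual [N(U) - L V] is [M (V - U)] in an eigenbasis of [L], with
    [M = l / (exp (dt l) - 1)] at the eigenvalue [l]; the correction of ETDRK2
    has a similar residual.  Testing with [V - U] bounds the change of the energy
    by minus a damping term plus a sum over pixels of
    [(b - 1) (V - U) ^ 2 / eps], where [b <= 1] as long as nothing overshoots.

    If [S >= 2 / eps] (then nothing overshoots) or if [M] is at least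
    [3 / (8 eps)] at [l = S], the damping wins and the energy decreases.
    Otherwise test with [V - U + chi V], where [chi] is increasing and supported
    on the overshoot, so that [D V] has a nonnegative product with [chi V]: the
    energy plus a penalty [psi] of the overshoot decreases, by a polynomial
    inequality at each pixel.

    A decrease that is strict unless [V = U] shows that a steady state is a fixed
    point of ETD1 even when the scheme is ETDRK2.  It then solves [L V = N(V)],
    and the discrete maximum principle puts it back in [0, 1], where [psi]
    vanishes.  So the energy at the steady state does not exceed the initial one,
    and the weighted averages minimize the energy in the intensities. *)

Require Import Defs.
From HB Require Import structures.
From mathcomp Require Import all_boot all_order all_algebra.
From mathcomp Require Import spectral sesquilinear.
From mathcomp.real_closed Require Import complex.
From mathcomp Require Import all_classical all_reals all_analysis.
From mathcomp Require Import ring lra zify.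

Set Implicit Arguments.
Unset Strict Implicit.
Unset Printing Implicit Defensive.

Import Order.TTheory GRing.Theory Num.Theory.
Import numFieldNormedType.Exports.
Local Open Scope classical_set_scope.
Local Open Scope ring_scope.

(** * Polynomial inequalities at a pixel *)

Section PixelPoly.
Variable R : realFieldType.
Implicit Types t a b d s : R.

(* [t = x - 1/2] and [a = x - y] for a pixel moving from [1/2 + x] to [1/2 + y]. *)
Lemma outside_inside_poly t a : 0 <= t -> 45 * t <= 2 -> t <= a -> 45 * a <= 49 ->
  a ^+ 2 * (6 * t - 2 * a + a ^+ 2 - 4 * t * a + 6 * t ^+ 2) <= 8 * t ^+ 3 + 9 * t ^+ 4.
Proof.
(* To leading order the left-hand side is [a ^ 2 * (6 t - 2 a)], whose maximum over [a >= 0] is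
   [8 t ^ 3], reached at [a = 2 t]. This fixes the cubic coefficient of the penalty and suggests
   expanding in [b]. *)
move=> t0 t1 ta a1; pose b := a - 2 * t.
have h1 : 0 <= b ^+ 2 * (2 * a + 2 * t - a ^+ 2 - (8 / 10) * t - 2 * t ^+ 2).
  by rewrite mulr_ge0 ?sqr_ge0 //; nra.
have h2 : 0 <= t * ((8 / 10) * b ^+ 2 - 8 * t ^+ 2 * b + t ^+ 3).
  rewrite mulr_ge0 //.
  have -> : 8 / 10 * b ^+ 2 - 8 * t ^+ 2 * b + t ^+ 3
     = 8 / 10 * (b - 5 * t ^+ 2) ^+ 2 + t ^+ 3 * (1 - 20 * t) by field.
  apply: addr_ge0; apply: mulr_ge0; rewrite ?sqr_ge0 ?exprn_ge0 //; lra.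
rewrite -subr_ge0; apply: le_trans (addr_ge0 h1 h2) _.
by rewrite /b le_eqVlt; apply/orP; left; apply/eqP; ring.
Qed.

(* A pixel moves from [1/2 + x] to [1/2 + y], [t] is the overshoot [y - 1/2] and
   [b = 1 - x - y], so that [y - x = b + 2 t]; the test function is [24 t ^ 2],
   the penalty is [8 t ^ 3 + 9 t ^ 4]. *)
Lemma inside_outside_poly_near t b : 0 <= t -> 45 * t <= 2 -> - t <= b -> b <= 0 ->
  - b ^+ 2 * (4 * (b + 2 * t) + 10 * t)
  + (b + 2 * t) ^+ 2 * (3 * b ^+ 2 + 4 * b * t + 2 * t ^+ 2)
  - 144 * t ^+ 2 * (t + b) ^+ 2 + 96 * t ^+ 2 * (t + b) ^+ 3 + 90 * t ^+ 4 <= 0.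
Proof.
move=> t0 t1 tb b0.
have [et|tn0] := eqVneq t 0.
  have eb : b = 0 by lra.
  by rewrite et eb; lra.
have tp : 0 < t by rewrite lt_def tn0.
(* With [b = v t] a factor [t ^ 3] splits off and leaves a nonpositive leading part plus [t K]. The
   [t] inside [K], then the one in front of it, are replaced by their largest value [2 / 45]. *)
pose v := b / t; have eb : b = v * t by rewrite /v; field.
have v1 : - 1 <= v by rewrite /v ler_pdivlMr //; lra.
have v0 : v <= 0 by rewrite /v ler_pdivrMr //; lra.
set K := 3 * v ^+ 4 + 16 * v ^+ 3 - 114 * v ^+ 2 - 264 * v - 46 + 96 * t * (1 + v) ^+ 3.
suff h : - v ^+ 2 * (18 + 4 * v) + t * K <= 0.
  have -> : - b ^+ 2 * (4 * (b + 2 * t) + 10 * t)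
  + (b + 2 * t) ^+ 2 * (3 * b ^+ 2 + 4 * b * t + 2 * t ^+ 2)
  - 144 * t ^+ 2 * (t + b) ^+ 2 + 96 * t ^+ 2 * (t + b) ^+ 3 + 90 * t ^+ 4
   = t ^+ 3 * (- v ^+ 2 * (18 + 4 * v) + t * K) by rewrite eb /K; ring.
  by rewrite mulr_ge0_le0 // exprn_ge0.
have w3 : 96 * t * (1 + v) ^+ 3 <= (96 * 2 / 45) * (1 + v) ^+ 3.
  by rewrite ler_wpM2r ?exprn_ge0 //; lra.
set K' := 3 * v ^+ 4 + 16 * v ^+ 3 - 114 * v ^+ 2 - 264 * v - 46 + (96 * 2 / 45) * (1 + v) ^+ 3.
have KK : K <= K' by rewrite /K /K'; lra.
have h1 : t * K <= t * K' by rewrite ler_wpM2l.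
have h2 : - v ^+ 2 * (18 + 4 * v) <= 0 by rewrite mulNr oppr_le0 mulr_ge0 ?sqr_ge0 //; lra.
have [K0|K0] := leP K' 0; first by nra.
have h3 : t * K' <= 2 / 45 * K' by rewrite ler_wpM2r ?(ltW K0) //; lra.
suff : - v ^+ 2 * (18 + 4 * v) + 2 / 45 * K' <= 0 by lra.
rewrite /K'.
have v2 : v ^+ 2 <= 1 by nra.
have v4 : v ^+ 4 <= v ^+ 2 by rewrite (exprD v 2 2) ler_piMl ?sqr_ge0.
have v3 : 0 <= (1 + v) * v ^+ 2 by rewrite mulr_ge0 ?sqr_ge0 //; lra.
(* The left-hand side peaks near [v = - 1 / 4]; this square vanishes close to there. *)
have e : 0 <= (10 * v + 3) ^+ 2 by apply: sqr_ge0.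
nra.
Qed.

(** For [b >= 0] the pixel starts at distance [t + b] below the upper end of [0, 1], where the
    fidelity force, of size [phi], may act: its range [|x| <= 1 / 6] reads [1 <= 3 (t + b) <= 2].
    Once the terms in [b ^ 2] are signed, there remains [t ^ 2] times a polynomial dominated by
    [(t + b) ^ 2]. *)
Lemma inside_outside_poly_far t b phi : 0 <= t -> 45 * t <= 2 -> 0 <= b ->
  45 * (t + b) <= 47 -> 0 <= phi -> 12 * phi <= 1 ->
  (phi = 0) \/ (1 <= 3 * (t + b) /\ 3 * (t + b) <= 2) ->
  - b ^+ 2 * (4 * (b + 2 * t) + 10 * t)
  + (b + 2 * t) ^+ 2 * (3 * b ^+ 2 + 4 * b * t + 2 * t ^+ 2)
  - 144 * t ^+ 2 * (t + b) ^+ 2 + 96 * t ^+ 2 * (t + b) ^+ 3 + 90 * t ^+ 4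
  + 24 * t ^+ 2 * phi <= 0.
Proof.
move=> t0 t1 b0 sb f0 f1 hf.
pose s := t + b; have tb : t <= s by rewrite /s; lra.
have s0 : 0 <= s by lra.
have s1 : 45 * s <= 47 by [].
have h1 : 0 <= b ^+ 2 * ((4 - 3 * (b + 2 * t) - 4 * t) * (b + 2 * t) + 10 * t).
  by rewrite mulr_ge0 ?sqr_ge0 // addr_ge0 ?mulr_ge0 //; lra.
have h2 : 0 <= t ^+ 2 * (132 * s ^+ 2 - 86 * t ^+ 2 - 96 * s ^+ 3 - 24 * phi).
  rewrite mulr_ge0 ?sqr_ge0 //.
  have t2 : t ^+ 2 <= s ^+ 2 by rewrite ler_sqr.
  have t3 : t ^+ 2 <= 4 / 2025 by nra.
  have e3 : s ^+ 3 = s * s ^+ 2 by rewrite exprS.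
  case: hf => [->|[]]; last first.
    rewrite -/s => l1 l2.
    have : (3 * s - 1) * (2 - 3 * s) >= 0 by rewrite mulr_ge0 //; lra.
    have : s ^+ 3 <= 2 / 3 * s ^+ 2 by rewrite e3 ler_wpM2r ?sqr_ge0 //; lra.
    nra.
  (* For small [s] the bound [t ^ 2 <= s ^ 2] is enough. For larger [s] the cubic term leaves less
     room, but [t ^ 2 <= 4 / 2025] is then negligible. *)
  have [l|l] := leP (20 * s) 9.
    have : s ^+ 3 <= 9 / 20 * s ^+ 2 by rewrite e3 ler_wpM2r ?sqr_ge0 //; lra.
    nra.
  have : s ^+ 3 <= 47 / 45 * s ^+ 2 by rewrite e3 ler_wpM2r ?sqr_ge0 //; lra.
  have : 81 / 400 <= s ^+ 2 by nra.
  nra.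
have h3 : 0 <= t ^+ 2 * (2 * b ^+ 2) by rewrite !mulr_ge0 ?sqr_ge0.
rewrite -oppr_ge0; apply: le_trans (addr_ge0 h3 (addr_ge0 h1 h2)) _.
by rewrite /s le_eqVlt; apply/orP; left; apply/eqP; ring.
Qed.
(* Both ends overshoot, by [t - d] before the move and by [t] after it. *)
Definition stay_outside t d s : R := d ^+ 2 * (2 * t + 4 * (t - d) + t ^+ 2 + 2 * t * (t - d)
     + 3 * (t - d) ^+ 2)
  - 24 * t ^+ 2 * (s * d + 2 * (t - d) + 6 * (t - d) ^+ 2 + 4 * (t - d) ^+ 3)
  + 8 * t ^+ 3 + 9 * t ^+ 4 - 8 * (t - d) ^+ 3 - 9 * (t - d) ^+ 4.

Lemma stay_outside_le t d s : 0 <= t -> 0 <= t - d ->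
  stay_outside t d s <= t ^+ 2 * (- 48 * t + (72 - 24 * s) * d) - 18 * t * d ^+ 2
               + 4 * d ^+ 3 + 10 * t ^+ 4.
Proof.
move=> t0; set u := t - d => u0.
have -> : stay_outside t d s = t ^+ 2 * (- 48 * t + (72 - 24 * s) * d) - 18 * t * d ^+ 2
               + 4 * d ^+ 3 + 10 * t ^+ 4 - (4 * t * u ^+ 3 + 6 * u ^+ 4 + 144 * t ^+ 2 * u ^+ 2
      + 96 * t ^+ 2 * u ^+ 3) by rewrite /stay_outside /u; ring.
by rewrite gerBl !addr_ge0 // !mulr_ge0 ?exprn_ge0.
Qed.

(** The extra [81 t ^ 4] is [9 / 64] times the square of the test function [24 t ^ 2]. The cubic
    terms dominate the quartic ones because [t <= 2 / 45]. *)
Lemma outside_outside_poly t d s : 0 <= t -> 45 * t <= 2 -> 0 <= t - d ->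
  45 * (t - d) <= 2 -> 1 <= s -> s <= 2 ->
  stay_outside t d s + 81 * t ^+ 4 <= 0.
Proof.
move=> t0 t1 u0 u1 s1 s2.
have := stay_outside_le s t0 u0; set u := t - d in u0 u1 *.
have -> : d = t - u by rewrite /u; ring.
have h1 : 0 <= t ^+ 2 * ((s - 1) * u) by rewrite mulr_ge0 ?exprn_ge0 // mulr_ge0 //; lra.
have h2 : 0 <= t ^+ 3 * (s - 1) by rewrite mulr_ge0 ?exprn_ge0 //; lra.
have h5 : 0 <= t ^+ 2 * ((2 - s) * u) by rewrite mulr_ge0 ?exprn_ge0 // mulr_ge0 //; lra.
have h3 : 0 <= t ^+ 3 * (2 - 45 * t) by rewrite mulr_ge0 ?exprn_ge0 //; lra.
have h4 : 0 <= t * u ^+ 2 by rewrite mulr_ge0 ?exprn_ge0.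
have h6 : 0 <= u ^+ 3 by rewrite exprn_ge0.
have h7 : 0 <= t ^+ 3 by rewrite exprn_ge0.
nra.
Qed.

(** The bracket is [- d ^ 2 / 2 - d c + 5 / 4 c ^ 2] for the test function [c = 24 t ^ 2]. The bound
    is affine in [(s, tau)], so it suffices to check it at the four vertices of the trapezoid
    [1 <= s <= 2], [0 <= tau <= 3 / 8 + s / 2]. *)
Lemma outside_outside_poly_damped t d s tau : 0 <= t -> 45 * t <= 2 -> 0 <= t - d ->
  45 * (t - d) <= 2 -> 1 <= s -> s <= 2 -> 0 <= tau -> tau <= 3 / 8 + s / 2 ->
  stay_outside t d s + tau * (- d ^+ 2 / 2 - 24 * t ^+ 2 * d + 720 * t ^+ 4) <= 0.
Proof.
move=> t0 t1 u0 u1 s1 s2 T0 T1.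
have t3 : 0 <= t ^+ 3 by rewrite exprn_ge0.
have t34 : 0 <= t ^+ 3 * (2 - 45 * t) by rewrite mulr_ge0 //; lra.
have td : 0 <= t * d ^+ 2 by rewrite mulr_ge0 ?sqr_ge0.
have ud : 0 <= (t - d) * d ^+ 2 by rewrite mulr_ge0 ?sqr_ge0.
have d3 : d ^+ 3 <= t * d ^+ 2 by lra.
pose f s tau := t ^+ 2 * (- 48 * t + (72 - 24 * s) * d) - 18 * t * d ^+ 2
               + 4 * d ^+ 3 + 10 * t ^+ 4
  + tau * (- d ^+ 2 / 2 - 24 * t ^+ 2 * d + 720 * t ^+ 4).
have f10 : f 1 0 <= 0.
  rewrite /f; have : 0 <= t ^+ 2 * (t - d) by rewrite mulr_ge0 ?sqr_ge0.
  by have := mulr_ge0 t0 (sqr_ge0 (d - t)); lra.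
have f20 : f 2 0 <= 0.
  rewrite /f; have : 0 <= t ^+ 2 * (t - d) by rewrite mulr_ge0 ?sqr_ge0.
  by have := mulr_ge0 t0 (sqr_ge0 (d - t)); lra.
have f11 : f 1 (7 / 8) <= 0.
  rewrite /f.
  suff : 0 <= 19 * t ^+ 3 - 27 * t ^+ 2 * d + (7 / 16) * d ^+ 2 + 14 * t * d ^+ 2.
    by lra.
  have k : 0 <= 19 - (2916 / 7) * t by lra.
  by have := sqr_ge0 (d - (216 / 7) * t ^+ 2); have := mulr_ge0 t3 k; lra.
have f21 : f 2 (11 / 8) <= 0.
  rewrite /f.
  suff : 0 <= 3 * t ^+ 3 + 9 * t ^+ 2 * d + (11 / 16) * d ^+ 2 by lra.
  have k : 0 <= 3 - (324 / 11) * t by lra.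
  by have := sqr_ge0 (d + (72 / 11) * t ^+ 2); have := mulr_ge0 t3 k; lra.
have bs := stay_outside_le s t0 u0.
suff : f s tau <= 0 by rewrite /f; lra.
pose T := 3 / 8 + s / 2; have Tp : 0 < T by rewrite /T; lra.
pose th := tau / T; have et : tau = th * T by rewrite /th; field; lra.
have th0 : 0 <= th by rewrite /th divr_ge0 // ltW.
have th1 : th <= 1 by rewrite /th ler_pdivrMr // mul1r.
have -> : f s tau = (1 - th) * ((2 - s) * f 1 0 + (s - 1) * f 2 0)
   + th * ((2 - s) * f 1 (7 / 8) + (s - 1) * f 2 (11 / 8)).
  by rewrite et /f /T; field.
have comb (u v x y : R) : 0 <= u -> 0 <= v -> x <= 0 -> y <= 0 -> u * x + v * y <= 0.
  by move=> u0' v0 x0 y0; rewrite -[0]addr0 lerD // mulr_ge0_le0.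
have A x y : x <= 0 -> y <= 0 -> (2 - s) * x + (s - 1) * y <= 0.
  by move=> *; apply: comb => //; rewrite subr_ge0.
have B : 0 <= 1 - th by rewrite subr_ge0.
by apply: comb => //; apply: A.
Qed.

End PixelPoly.

(** * The test function and the penalty *)

Section Pixel.
Variable R : realFieldType.
Implicit Types t a b d s x y : R.

Definition overshoot (x : R) : R := Num.max 0 (x - 2^-1).
(** The derivative of the cubic part of the penalty [psi]; it is odd, while [psi] is even. *)
Definition chi (x : R) : R := 24 * (overshoot x ^+ 2 - overshoot (- x) ^+ 2).
Definition psi (x : R) : R :=
  8 * (overshoot x ^+ 3 + overshoot (- x) ^+ 3) + 9 * (overshoot x ^+ 4 + overshoot (- x) ^+ 4).
(** The second-order Taylor quotient of the double well, in variables centred at 1/2. *)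
Definition breg (x y : R) : R := y ^+ 2 + 2 * x * y + 3 * x ^+ 2 - 2^-1.

Lemma overshoot0 x : x <= 2^-1 -> overshoot x = 0.
Proof. by move=> h; rewrite /overshoot; apply/max_idPl; lra. Qed.
Lemma overshootE x : 2^-1 <= x -> overshoot x = x - 2^-1.
Proof. by move=> h; rewrite /overshoot; apply/max_idPr; lra. Qed.
Lemma overshoot_ge0 x : 0 <= overshoot x. Proof. by rewrite /overshoot le_max lexx. Qed.
Lemma psi_ge0 x : 0 <= psi x.
Proof. by rewrite /psi addr_ge0 // mulr_ge0 // addr_ge0 // exprn_ge0 // overshoot_ge0. Qed.
Lemma chiN x : chi (- x) = - chi x. Proof. by rewrite /chi opprK; ring. Qed.
Lemma psiN x : psi (- x) = psi x. Proof. by rewrite /psi opprK; ring. Qed.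

(** The end point carries neither test function nor penalty. If the start is inside too,
    [breg <= 1]; otherwise the penalty at the start pays for the excess. *)
Let pixel_inside x y : `|x| <= 49 / 90 -> `|y| <= 2^-1 ->
  (breg x y - 1) * (y - x) ^+ 2 - psi x <= 0.
Proof.
wlog x0 : x y / 0 <= x.
  move=> hw hx hy; have [|x0] := leP 0 x; first by move/hw; apply.
  have := hw (- x) (- y); rewrite psiN oppr_ge0 !normrN => /(_ (ltW x0) hx hy).
  suff -> : (breg (- x) (- y) - 1) * (- y - - x) ^+ 2 = (breg x y - 1) * (y - x) ^+ 2 by [].
  by rewrite /breg; ring.
rewrite !ler_norml => /andP[x1 x2] /andP[y1 y2].
have [xh|xh] := leP x 2^-1.
  have : breg x y <= 1 by rewrite /breg; nra.
  move=> r1; have := psi_ge0 x.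
  have : (breg x y - 1) * (y - x) ^+ 2 <= 0 by rewrite mulr_le0_ge0 ?sqr_ge0 //; lra.
  lra.
have h := @outside_inside_poly R (x - 2^-1) (x - y).
rewrite /psi (overshootE (ltW xh)) overshoot0 ?expr0n /=; last by lra.
rewrite !addr0 subr_le0; apply: le_trans (h _ _ _ _); try lra.
by rewrite le_eqVlt; apply/orP; left; apply/eqP; rewrite /breg; field.
Qed.

Let chi_inside y : `|y| <= 2^-1 -> chi y = 0 /\ psi y = 0.
Proof.
rewrite ler_norml => /andP[y1 y2].
by rewrite /chi /psi !overshoot0 ?expr0n /= ?subr0 ?addr0 ?mulr0 //; lra.
Qed.

Let pixel_from_inside x y s phi : - (49 / 90) <= x -> x <= 2^-1 -> y <= 49 / 90 ->
  2^-1 <= y -> 1 <= s -> `|phi| <= 12^-1 -> phi = 0 \/ `|x| <= 6^-1 ->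
  (breg x y - 1) * (y - x) ^+ 2 - (s * (y - x) + (4 * x ^+ 3 - x) + phi) * chi y
    + 9 / 64 * chi y ^+ 2 + psi y <= 0.
Proof.
move=> x1 x2 y2 y1 s1 hphi hphi'.
move: hphi; rewrite !ler_norml => /andP[p1 p2].
rewrite /psi /chi (overshootE y1) !overshoot0 ?expr0n /=; last by lra.
pose t := y - 2^-1; pose b := 1 - x - y.
have e1 : y = 2^-1 + t by rewrite /t; ring.
have e2 : x = 2^-1 - (t + b) by rewrite /t /b; field.
rewrite -/t; pose a := b + 2 * t.
(* The pixel moves upwards, so [s] may be lowered to 1. *)
have hs : 0 <= t ^+ 2 * ((s - 1) * a).
  by rewrite mulr_ge0 ?sqr_ge0 // mulr_ge0 //; rewrite /a /b /t; lra.
suff : - b ^+ 2 * (4 * (b + 2 * t) + 10 * t)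
  + (b + 2 * t) ^+ 2 * (3 * b ^+ 2 + 4 * b * t + 2 * t ^+ 2)
  - 144 * t ^+ 2 * (t + b) ^+ 2 + 96 * t ^+ 2 * (t + b) ^+ 3 + 90 * t ^+ 4
  - 24 * t ^+ 2 * phi <= 0.
  move=> h; rewrite -oppr_ge0; rewrite -oppr_ge0 in h.
  apply: le_trans (addr_ge0 h (mulr_ge0 (ler0n _ 24) hs)) _.
  by rewrite le_eqVlt; apply/orP; left; apply/eqP; rewrite /breg e1 e2 /a; field.
have t0 : 0 <= t by rewrite /t; lra.
have t1 : 45 * t <= 2 by rewrite /t; lra.
have [b0|b0] := leP b 0.
  have -> : phi = 0.
    case: hphi' => //; rewrite ler_norml => /andP[x3 x4].
    by move: b0; rewrite /b => b0; exfalso; lra.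
  rewrite mulr0 subr0; apply: inside_outside_poly_near => //; rewrite /b /t; lra.
have hb : 45 * (t + b) <= 47 by rewrite /b /t; lra.
have := @inside_outside_poly_far R t b `|phi| t0 t1 (ltW b0) hb (normr_ge0 _).
have q1 : 12 * `|phi| <= 1 by have : `|phi| <= 12^-1 by [rewrite ler_norml; lra]; lra.
have q2 : `|phi| = 0 \/ 1 <= 3 * (t + b) /\ 3 * (t + b) <= 2.
  case: hphi' => [->|]; first by left; rewrite normr0.
  by rewrite ler_norml => /andP[x3 x4]; right; rewrite /b /t; split; lra.
move=> /(_ q1 q2).
have : 0 <= t ^+ 2 * (`|phi| + phi).
  by rewrite mulr_ge0 ?sqr_ge0 //; have := ler_norm (- phi); rewrite normrN; lra.
lra.
Qed.

Let pixel_outside_outside x y s phi : 2^-1 <= x -> x <= 49 / 90 -> 2^-1 <= y -> y <= 49 / 90 ->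
  phi = 0 \/ `|x| <= 6^-1 ->
  (breg x y - 1) * (y - x) ^+ 2 - (s * (y - x) + (4 * x ^+ 3 - x) + phi) * chi y
    + psi y - psi x = stay_outside (y - 2^-1) (y - x) s.
Proof.
move=> x1 x2 y1 y2 hphi.
have -> : phi = 0.
  by case: hphi => //; rewrite ler_norml => /andP[x3 x4]; exfalso; lra.
rewrite /psi /chi (overshootE y1) (overshootE x1) !overshoot0 ?expr0n /=; try lra.
by rewrite /breg /stay_outside; field.
Qed.

Let stage_symmetry (P : R -> R -> R -> Prop) :
  (forall x y phi, 0 <= y -> P x y phi) ->
  (forall x y phi, P (- x) (- y) (- phi) -> P x y phi) -> forall x y phi, P x y phi.
Proof.
move=> h1 h2 x y phi; have [|y0] := leP 0 y; first exact: h1.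
by apply: h2; apply: h1; rewrite oppr_ge0 ltW.
Qed.

(** Here [s] stands for [S eps], [phi] for the fidelity force times [eps], and [4 x ^ 3 - x] is
    [dwell'] centred at 1/2. The coefficient [9 / 64] is the [3 / 8] of [damping1_chi] times the
    bound [3 / 8] on [eps] times the damping at [S]. *)
Lemma pixel_stage1 x y s phi : `|x| <= 49 / 90 -> `|y| <= 49 / 90 -> 1 <= s -> s <= 2 ->
  `|phi| <= 12^-1 -> phi = 0 \/ `|x| <= 6^-1 ->
  (breg x y - 1) * (y - x) ^+ 2 - (s * (y - x) + (4 * x ^+ 3 - x) + phi) * chi y
    + 9 / 64 * chi y ^+ 2 + psi y <= psi x.
Proof.
move=> hx hy s1 s2 hp; move: x y phi hx hy hp.
apply: stage_symmetry => [x y phi y0 hx hy|x y phi]; last first.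
  rewrite !psiN chiN !normrN => h0 hx hy hp hp'.
  have hp2 : - phi = 0 \/ `|x| <= 6^-1.
    by case: hp' => [->|?]; [left; rewrite oppr0|right].
  by have := h0 hx hy hp hp2; rewrite /breg; lra.
move=> hphi hphi'; move: (hx) (hy); rewrite !ler_norml => /andP[x1 x2] /andP[y1 y2].
have [yh|/ltW yh] := leP y 2^-1.
  have yi : `|y| <= 2^-1 by rewrite ler_norml; lra.
  have [-> ->] := chi_inside yi; rewrite mulr0 expr0n mulr0 subr0 !addr0 -subr_le0.
  exact: pixel_inside.
have [xh|/ltW xh] := leP x 2^-1.
  by apply: le_trans (psi_ge0 x); apply: pixel_from_inside.
have e := @pixel_outside_outside x y s phi xh x2 yh y2 hphi'.
have ec : chi y = 24 * (y - 2^-1) ^+ 2.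
  by rewrite /chi (overshootE yh) overshoot0 ?expr0n /= ?subr0 //; lra.
have := @outside_outside_poly R (y - 2^-1) (y - x) s.
rewrite -e ec => h; rewrite -subr_le0; apply: le_trans (h _ _ _ _ s1 s2); lra.
Qed.

(** The version for the corrector of ETDRK2: [tau] stands for [eps / dt], and its bracket is what
    [damping2_chi] leaves of the corrector residual. *)
Lemma pixel_stage2 x y s phi tau : `|x| <= 49 / 90 -> `|y| <= 49 / 90 -> 1 <= s -> s <= 2 ->
  `|phi| <= 12^-1 -> phi = 0 \/ `|x| <= 6^-1 -> 0 <= tau -> tau <= 3 / 8 + s / 2 ->
  (breg x y - 1) * (y - x) ^+ 2 - (s * (y - x) + (4 * x ^+ 3 - x) + phi) * chi y
    + tau * (- (y - x) ^+ 2 / 2 - (y - x) * chi y + 5 / 4 * chi y ^+ 2) + psi y <= psi x.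
Proof.
move=> hx hy s1 s2 hp hp' T0 T1; move: x y phi hx hy hp hp'.
apply: stage_symmetry => [x y phi y0 hx hy|x y phi]; last first.
  rewrite !psiN chiN !normrN => h0 hx hy hp hp'.
  have hp2 : - phi = 0 \/ `|x| <= 6^-1.
    by case: hp' => [->|?]; [left; rewrite oppr0|right].
  by have := h0 hx hy hp hp2; rewrite /breg; lra.
move=> hphi hphi'; move: (hx) (hy); rewrite !ler_norml => /andP[x1 x2] /andP[y1 y2].
have [yh|/ltW yh] := leP y 2^-1.
  have yi : `|y| <= 2^-1 by rewrite ler_norml; lra.
  have [-> ->] := chi_inside yi; rewrite !mulr0 expr0n mulr0 subr0 !addr0.
  have := mulr_ge0 T0 (sqr_ge0 (y - x)); have := pixel_inside hx yi; lra.
have ec : chi y = 24 * (y - 2^-1) ^+ 2.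
  by rewrite /chi (overshootE yh) overshoot0 ?expr0n /= ?subr0 //; lra.
pose t := y - 2^-1; have t0 : 0 <= t by rewrite /t; lra.
have t1 : 45 * t <= 2 by rewrite /t; lra.
have [xh|/ltW xh] := leP x 2^-1.
  apply: le_trans (psi_ge0 x).
  have h := pixel_from_inside x1 xh y2 yh s1 hphi hphi'.
  (* When the start is inside, the bracket is nonpositive by itself and the estimate without [tau]
     applies. *)
  suff h' : tau * (- (y - x) ^+ 2 / 2 - (y - x) * chi y + 5 / 4 * chi y ^+ 2) <= 0.
    by have := sqr_ge0 (chi y); lra.
  rewrite mulr_ge0_le0 // ec -/t; pose a := y - x; rewrite -/a.
  have ta : t <= a by rewrite /t /a; lra.
  have t2 : t ^+ 2 <= a ^+ 2 by rewrite ler_sqr ?nnegrE //; lra.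
  have t3 : t ^+ 2 * t <= t ^+ 2 * a by rewrite ler_wpM2l ?sqr_ge0.
  have t4 : t ^+ 2 * (45 * t) <= t ^+ 2 * 2 by rewrite ler_wpM2l ?sqr_ge0.
  have t5 : t ^+ 2 * t * (45 * t) <= t ^+ 2 * t * 2 by rewrite ler_wpM2l // mulr_ge0 ?sqr_ge0.
  have t6 : 0 <= t ^+ 2 * (2 - 45 * t) by rewrite mulr_ge0 ?sqr_ge0 //; lra.
  have e4 : t ^+ 4 = t ^+ 2 * t * t by ring.
  nra.
have e := @pixel_outside_outside x y s phi xh x2 yh y2 hphi'.
have := @outside_outside_poly_damped R t (y - x) s tau.
rewrite -e ec => h; rewrite -subr_le0; apply: le_trans (h _ _ _ _ s1 s2 T0 T1); rewrite /t; lra.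
Qed.

End Pixel.

(** * Scalar exponential integrators *)

Section ExpScalars.
Variable R : realType.
Implicit Types x y : R.

Lemma is_derive_mean (f df : R -> R) x y : (forall z : R, is_derive z 1 f (df z)) -> x <= y ->
  exists2 z, x <= z <= y & f y - f x = df z * (y - x).
Proof.
move=> hf xy.
have [z] := @MVT_segment R f df x y xy (fun z _ => hf z)
  (derivable_within_continuous (fun z _ => @ex_derive _ _ _ _ _ _ _ (hf z))).
by rewrite in_itv /=; exists z.
Qed.

Lemma is_derive_ge0_le (f df : R -> R) x y : (forall z : R, is_derive z 1 f (df z)) ->
  (forall z, x <= z -> 0 <= df z) -> x <= y -> f x <= f y.
Proof.
move=> hf hd xy; have [z /andP[xz _] e] := is_derive_mean hf xy.
by rewrite -subr_ge0 e mulr_ge0 ?hd // subr_ge0.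
Qed.

Lemma expR_sub1_le x : 0 <= x -> 0 <= (x - 1) * expR x + 1.
Proof.
move=> x0; have h := expR_ge1Dx (- x); rewrite expRN in h.
have E0 := expR_gt0 x.
have : expR x * (1 + - x) <= expR x * (expR x)^-1 by rewrite ler_wpM2l // ltW.
by rewrite divff ?gt_eqF //; lra.
Qed.

Lemma expR_sub1_lt x : 0 < x -> 0 < (x - 1) * expR x + 1.
Proof.
move=> x0; have h : 1 + - x < expR (- x) by apply: expR_gt1Dx; rewrite oppr_eq0 gt_eqF.
rewrite expRN in h; have E0 := expR_gt0 x.
have : expR x * (1 + - x) < expR x * (expR x)^-1 by rewrite ltr_pM2l.
by rewrite divff ?gt_eqF //; lra.
Qed.

Lemma expR_sub2_ge0 x : 0 <= x -> 0 <= (x - 2) * expR x + x + 2.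
Proof.
move=> x0.
have := @is_derive_ge0_le (fun z => (z - 2) * expR z + z + 2)
  (fun z => (z - 1) * expR z + 1) 0 x _ expR_sub1_le x0.
rewrite expR0 => h; suff : (0 - 2) * 1 + 0 + 2 <= (x - 2) * expR x + x + 2 by lra.
by apply: h => z; apply: is_derive_eq; rewrite /GRing.scale /=; ring.
Qed.

Lemma sinh_ge x : 0 <= x -> 2 * x <= expR x - expR (- x).
Proof.
move=> x0.
have := @is_derive_ge0_le (fun z => expR z - expR (- z) - 2 * z)
  (fun z => expR z + expR (- z) - 2) 0 x _ _ x0.
rewrite oppr0 expR0; move=> h; suff : 1 - 1 - 2 * 0 <= expR x - expR (- x) - 2 * x by lra.
apply: h => z; last first.
  move=> z0; rewrite expRN; have E0 := expR_gt0 z.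
  have -> : expR z + (expR z)^-1 - 2 = (expR z - 1) ^+ 2 / expR z.
    by field; rewrite gt_eqF.
  by rewrite divr_ge0 ?sqr_ge0 // ltW.
by apply: is_derive_eq; rewrite /GRing.scale /=; ring.
Qed.

(** This is [sinh (x / 2) >= x / 2], squared and multiplied by [4 exp x]. *)
Lemma sqr_expR_sub1_ge x : 0 <= x -> x ^+ 2 * expR x <= (expR x - 1) ^+ 2.
Proof.
move=> x0; have h := @sinh_ge (x / 2) (divr_ge0 x0 (ler0n _ 2)).
have e : expR x = expR (x / 2) ^+ 2 by rewrite expr2 -expRD; congr expR; field.
have E0 := expR_gt0 (x / 2); rewrite expRN in h; set X := expR (x / 2) in e E0 h.
have h2 : x * X <= X ^+ 2 - 1.
  have : X * x <= X * (X - X^-1) by rewrite ler_wpM2l ?(ltW E0) //; lra.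
  by rewrite mulrBr divff ?gt_eqF //; lra.
have h3 : 0 <= x * X by rewrite mulr_ge0 // ltW.
rewrite e; have -> : x ^+ 2 * X ^+ 2 = (x * X) ^+ 2 by ring.
by rewrite ler_sqr ?nnegrE //; lra.
Qed.

(** Cross-multiplied form of the decrease of [x / (exp x - 1)]: the difference of the sides vanishes
    at [y = x] and has a nonnegative derivative in [y]. *)
Lemma bernoulli_le x y : 0 < x -> x <= y -> y * (expR x - 1) <= x * (expR y - 1).
Proof.
move=> x0 xy.
have := @is_derive_ge0_le (fun z => x * (expR z - 1) - z * (expR x - 1))
  (fun z => x * expR z - (expR x - 1)) x y _ _ xy.
rewrite subrr => h; rewrite -subr_ge0; apply: h => z; last first.
  move=> xz; have : expR x <= expR z by rewrite ler_expR.
  move=> h; have : x * expR x <= x * expR z by rewrite ler_wpM2l // ltW.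
  by have := expR_sub1_le (ltW x0); lra.
by apply: is_derive_eq; rewrite /GRing.scale /=; ring.
Qed.

(** Cross-multiplied form of the growth of [x coth (x / 2)]. The derivative [dg] is nonnegative at
    [x] by [sinh_ge], and nondecreasing from there on. *)
Lemma coth_le x y : 0 < x -> x <= y ->
  x * (expR x + 1) * (expR y - 1) <= y * (expR y + 1) * (expR x - 1).
Proof.
move=> x0 xy; set X := expR x.
have X1 : 1 + x <= X by apply: expR_ge1Dx.
pose dg z := (expR z + 1 + z * expR z) * (X - 1) - x * (X + 1) * expR z.
have dg_ge0 z : x <= z -> 0 <= dg z.
  move=> xz; apply: (@le_trans _ _ (dg x)).
    rewrite /dg -/X.
    have -> : (X + 1 + x * X) * (X - 1) - x * (X + 1) * X = X * (X - X^-1 - 2 * x).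
      by field; rewrite gt_eqF ?expR_gt0.
    rewrite mulr_ge0 ?(ltW (expR_gt0 _)) // /X -expRN.
    by have := sinh_ge (ltW x0); lra.
  apply: (@is_derive_ge0_le _ (fun z => expR z * ((2 + z) * (X - 1) - x * (X + 1)))) => //.
    by move=> w; rewrite /dg; apply: is_derive_eq; rewrite /GRing.scale /=; ring.
  move=> w xw; rewrite mulr_ge0 ?(ltW (expR_gt0 _)) //.
  have : 0 <= (w - x) * (X - 1) by rewrite mulr_ge0 //; lra.
  lra.
have := @is_derive_ge0_le (fun z => z * (expR z + 1) * (X - 1) - x * (X + 1) * (expR z - 1))
  dg x y _ dg_ge0 xy.
rewrite subrr => h; rewrite -subr_ge0; apply: h => z.
by apply: is_derive_eq; rewrite /GRing.scale /dg /=; ring.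
Qed.

End ExpScalars.

(** * Damping coefficients of the two schemes *)

Section Damping.
Variable R : realType.
Implicit Types l u v w n d e p q : R.

(** With [phi1] and [phi2] taken at [dt l], [damp1] is [1 / (dt phi1) - l] and [damp2] is
    [1 / (dt phi2) - l - 1 / dt]: the factors that turn an increment into a residual. *)
Definition damp1 (dt l : R) : R := l / (expR (dt * l) - 1).
Definition damp2 (dt l : R) : R :=
  dt^-1 * ((expR (dt * l) - 1 - dt * l) / ((dt * l - 1) * expR (dt * l) + 1)).

Variable dt : R.
Hypothesis dt_gt0 : 0 < dt.

Let x_gt0 l : 0 < l -> 0 < dt * l. Proof. exact: mulr_gt0. Qed.
Let E_gt1 l : 0 < l -> 0 < expR (dt * l) - 1.
Proof. by move=> l0; rewrite subr_gt0 pexpR_gt1 // x_gt0. Qed.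

Lemma etd1_coord l u v n : 0 < l ->
  v = phi0 (dt * l) * u + dt * (phi1 (dt * l) * n) ->
  n - l * v = damp1 dt l * (v - u).
Proof.
move=> l0 ->; rewrite /phi0 /phi1 /damp1 expRN.
have := E_gt1 l0; have := expR_gt0 (dt * l); set E := expR _ => E0 E1.
by field; rewrite !gt_eqF // ltrDl.
Qed.

Lemma etdrk2_coord l u v w n n' : 0 < l ->
  n - l * v = damp1 dt l * (v - u) -> w = v + dt * (phi2 (dt * l) * (n' - n)) ->
  n' - l * w = (dt^-1 + damp2 dt l) * (w - v) + damp1 dt l * (v - u).
Proof.
move=> l0 h ->; rewrite -h /phi2 /damp2 expRN.
have x0 := x_gt0 l0.
have := expR_sub1_lt x0; have := expR_gt0 (dt * l); set E := expR _ => E0 E2.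
by field; rewrite (gt_eqF E2) !gt_eqF.
Qed.

Lemma damp1_gt0 l : 0 < l -> 0 < damp1 dt l.
Proof. by move=> l0; rewrite divr_gt0 // E_gt1. Qed.

Lemma damp1_le_damp2 l : 0 < l -> damp1 dt l <= damp2 dt l.
Proof.
move=> l0; have x0 := x_gt0 l0; have E1 := E_gt1 l0; have E2 := expR_sub1_lt x0.
have -> : damp1 dt l = dt^-1 * (dt * l / (expR (dt * l) - 1)).
  by rewrite /damp1; field; rewrite !gt_eqF.
rewrite /damp2 ler_pM2l ?invr_gt0 // ler_pdivrMr // mulrAC ler_pdivlMr //.
by have := sqr_expR_sub1_ge (ltW x0); lra.
Qed.

Lemma damp2_le l : 0 < l -> damp2 dt l <= dt^-1.
Proof.
move=> l0; have x0 := x_gt0 l0; have E2 := expR_sub1_lt x0.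
rewrite /damp2 ler_piMr ?invr_ge0 ?(ltW dt_gt0) // ler_pdivrMr // mul1r.
by have := expR_sub2_ge0 (ltW x0); lra.
Qed.

Lemma damp1_nincr l1 l2 : 0 < l1 -> l1 <= l2 -> damp1 dt l2 <= damp1 dt l1.
Proof.
move=> l0 ll; have l20 := lt_le_trans l0 ll.
have x0 := x_gt0 l0; have E1 := E_gt1 l0; have E2 := E_gt1 l20.
rewrite /damp1 ler_pdivrMr // mulrAC ler_pdivlMr //.
rewrite -(ler_pM2l dt_gt0) !mulrA; apply: bernoulli_le => //.
by rewrite ler_pM2l.
Qed.

(** Both sides have the form [(l / 2) coth (dt l / 2)]: half of the diffusion makes up for the decay
    of [damp1] at high frequency. *)
Lemma damp1_half l1 l2 : 0 < l1 -> l1 <= l2 ->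
  damp1 dt l1 + l1 / 2 <= damp1 dt l2 + l2 / 2.
Proof.
move=> l0 ll; have l20 := lt_le_trans l0 ll.
have x0 := x_gt0 l0; have E1 := E_gt1 l0; have E2 := E_gt1 l20.
have e l : 0 < l -> damp1 dt l + l / 2 = l * (expR (dt * l) + 1) / (2 * (expR (dt * l) - 1)).
  by move=> lp; have := E_gt1 lp => ?; rewrite /damp1; field; rewrite gt_eqF.
rewrite !e // ler_pdivrMr ?mulr_gt0 // mulrAC ler_pdivlMr ?mulr_gt0 //.
have xx : dt * l1 <= dt * l2 by rewrite ler_pM2l.
rewrite -(ler_pM2l dt_gt0); have := coth_le x0 xx; lra.
Qed.

Lemma damp1_ge l : 0 < l -> dt^-1 <= damp1 dt l + l / 2.
Proof.
move=> l0; have x0 := x_gt0 l0; have E1 := E_gt1 l0.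
have -> : damp1 dt l + l / 2
    = dt^-1 * (dt * l * (expR (dt * l) + 1) / (2 * (expR (dt * l) - 1))).
  by rewrite /damp1; field; rewrite !gt_eqF.
rewrite ler_peMr ?invr_ge0 ?(ltW dt_gt0) // ler_pdivlMr ?mulr_gt0 // mul1r.
by have := expR_sub2_ge0 (ltW x0); lra.
Qed.

Lemma damp1_le l : 0 < l -> damp1 dt l <= dt^-1.
Proof. by move=> l0; apply: le_trans (damp1_le_damp2 l0) (damp2_le l0). Qed.

End Damping.

(** * Quadratic forms in one frame coordinate *)

Section Forms.
Variable R : realFieldType.
Implicit Types M N m tau d e p q : R.

Lemma damping1_chi M d p : 0 <= M ->
  - (M * d * (d + p)) <= - (M / 16 * d ^+ 2) + 3 / 8 * (M * p ^+ 2).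
Proof.
move=> M0; have := mulr_ge0 M0 (sqr_ge0 (d + 8 / 15 * p)).
by have := mulr_ge0 M0 (sqr_ge0 p); lra.
Qed.

(** Here [d], [e] are the increments of predictor and corrector, and [p], [q] their test functions.
    The difference of the sides is a combination, with weights [tau - N], [N - M] and [M], of sums
    of squares; the last one comes from completing squares in [d], [p], [e], [q] in turn. *)
Lemma damping2_chi M N tau d e p q : 0 <= M -> M <= N -> N <= tau ->
  - (M * d * (d + p)) - ((tau + N) * e + M * d) * (e + q)
  <= - (M / 16 * d ^+ 2) + 3 / 8 * (M * p ^+ 2)
     + tau * (- e ^+ 2 / 2 - e * q + 5 / 4 * q ^+ 2).
Proof.
move=> M0 MN Nt.
have h1 : 0 <= (tau - N) * (e ^+ 2 / 2 + 5 / 4 * q ^+ 2).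
  by rewrite mulr_ge0 ?subr_ge0 // addr_ge0 // mulr_ge0 ?sqr_ge0.
have h2 : 0 <= (N - M) * (3 / 2 * (e + q / 3) ^+ 2 + 13 / 12 * q ^+ 2).
  by rewrite mulr_ge0 ?subr_ge0 // addr_ge0 // mulr_ge0 ?sqr_ge0.
have h3 : 0 <= M * (15 / 16 * (d + 8 / 15 * (p + e + q)) ^+ 2
    + 13 / 120 * (p - 32 / 13 * (e + q)) ^+ 2 + 15 / 26 * (e - 11 / 15 * q) ^+ 2
    + 1 / 60 * q ^+ 2).
  rewrite mulr_ge0 //; do 3?[apply: addr_ge0]; by rewrite mulr_ge0 ?sqr_ge0.
rewrite -subr_ge0; apply: le_trans (addr_ge0 h1 (addr_ge0 h2 h3)) _.
by rewrite le_eqVlt; apply/orP; left; apply/eqP; field.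
Qed.

Lemma damping1_energy M D m d : 0 <= m -> m <= M + D / 2 ->
  - (M * d * d) - D / 2 * d ^+ 2 <= - (3 / 4 * m * d ^+ 2).
Proof.
move=> m0 mM; have : 0 <= (M + D / 2 - m) * d ^+ 2 by rewrite mulr_ge0 ?sqr_ge0 // subr_ge0.
by have := mulr_ge0 m0 (sqr_ge0 d); lra.
Qed.

(** The coupling [M d e] of the corrector is absorbed by [d ^ 2 + d e + e ^ 2 = 3 / 4 d ^ 2 + (d / 2
    + e) ^ 2], whence the factor [3 / 4]. *)
Lemma damping2_energy M N D m tau d e : 0 <= m -> 0 <= M -> M <= N -> 0 <= D ->
  m <= M + D / 2 -> m <= tau ->
  - (M * d * d) - D / 2 * d ^+ 2 - ((tau + N) * e + M * d) * e - D / 2 * e ^+ 2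
  <= - (3 / 4 * m * (d ^+ 2 + e ^+ 2)).
Proof.
move=> m0 M0 MN D0 mM mt.
have h1 : 0 <= 3 / 4 * ((M + D / 2 - m) * d ^+ 2).
  by apply: mulr_ge0 => //; rewrite mulr_ge0 ?sqr_ge0 // subr_ge0.
have h2 : 0 <= M * (d / 2 + e) ^+ 2 by rewrite mulr_ge0 ?sqr_ge0.
have h3 : 0 <= (N - M) * e ^+ 2 by rewrite mulr_ge0 ?sqr_ge0 // subr_ge0.
have h4 : 0 <= (tau - m) * e ^+ 2 by rewrite mulr_ge0 ?sqr_ge0 // subr_ge0.
have h5 : 0 <= D * e ^+ 2 by rewrite mulr_ge0 ?sqr_ge0.
have h6 : 0 <= D * d ^+ 2 by rewrite mulr_ge0 ?sqr_ge0.
have h7 : 0 <= m * e ^+ 2 by rewrite mulr_ge0 ?sqr_ge0.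
lra.
Qed.

End Forms.

(** * Spectral decomposition *)

Section Spectral.
Variable R : realType.
Local Notation toC := (real_complex R).
Local Notation cRe := (@complex.Re R).
Local Notation cIm := (@complex.Im R).

(* The real and imaginary parts of a complex unitary diagonalization form a
   tight frame of real eigenvectors; it replaces an orthonormal eigenbasis. *)
Lemma symmetric_frame n (A : 'M[R]_n) : A^T = A ->
  exists (P : 'M[R]_(n + n, n)) (d : 'rV[R]_(n + n)),
    P^T *m P = 1%:M /\ P *m A = diag_mx d *m P.
Proof.
move=> As; pose Ac := map_mx toC A.
have Ah : Ac \is hermsymmx.
  apply: realsym_hermsym.
    by apply/is_hermitianmxP; rewrite expr0 scale1r map_mx_id // /Ac map_trmx As.
  by apply/mxOverP => i j; rewrite mxE complex_real.
pose Q := spectralmx Ac; pose s := spectral_diag Ac.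
have eQ : Q *m Ac = diag_mx s *m Q.
  have /hermitian_normalmx /orthomx_spectralP {1}-> := Ah.
  by rewrite -mulmxA mulKVmx ?spectral_unit.
have Qu : Q \is unitarymx := spectral_unitarymx Ac.
have sr k : s 0 k = toC (cRe (s 0 k)).
  by have /mxOverP/(_ 0 k) := hermitian_spectral_diag_real Ah => /RRe_real.
exists (col_mx (map_mx cRe Q) (map_mx cIm Q)), (row_mx (map_mx cRe s) (map_mx cRe s)).
split.
  apply/matrixP => i j; rewrite tr_col_mx mul_row_col !mxE.
  have /matrixP/(_ j i) : invmx Q *m Q = 1%:M by rewrite mulVmx ?spectral_unit.
  rewrite invmx_unitary // !mxE => /(congr1 cRe); rewrite eq_sym.
  have -> : cRe ((i == j)%:R : R[i]) = (i == j)%:R by case: (i == j).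
  move <-; rewrite -big_split /= raddf_sum; apply: eq_bigr => k _; rewrite !mxE.
  case: (Q k i) (Q k j) => [a b] [c e] /=; ring.
apply/matrixP => i j; rewrite mul_col_mx diag_mx_row mul_block_col !mul0mx addr0 add0r.
have hj k : \sum_l Q k l * toC (A l j) = toC (cRe (s 0 k)) * Q k j.
  have /matrixP/(_ k j) := eQ; rewrite mul_diag_mx !mxE -sr => <-.
  by apply: eq_bigr => l _; rewrite mxE.
case: (split_ordP i) => k ->; rewrite ?col_mxEu ?col_mxEd mul_diag_mx !mxE.
  have := congr1 cRe (hj k); rewrite raddf_sum /=.
  case: (Q k j) => a b /=; rewrite mul0r subr0 => <-.
  by apply: eq_bigr => l _; rewrite !mxE; case: (Q k l) => x y /=; ring.
have := congr1 cIm (hj k); rewrite raddf_sum /=.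
case: (Q k j) => a b /=; rewrite mul0r addr0 => <-.
by apply: eq_bigr => l _; rewrite !mxE; case: (Q k l) => x y /=; ring.
Qed.

(** An entry of [X] is nonzero only where the two eigenvalues agree, and then so do their images
    under [f]. *)
Lemma intertwine_map m n (X : 'M[R]_(m, n)) (d : 'rV_m) (d' : 'rV_n) (f : R -> R) :
  X *m diag_mx d' = diag_mx d *m X ->
  X *m diag_mx (map_mx f d') = diag_mx (map_mx f d) *m X.
Proof.
move=> /matrixP h; apply/matrixP => i j; have := h i j.
rewrite !mul_mx_diag !mul_diag_mx !mxE; have [->|x0] := eqVneq (X i j) 0.
  by move=> _; rewrite mul0r mulr0.
by rewrite mulrC => /(mulIf x0) ->; rewrite mulrC.
Qed.

(** Whatever diagonalization [mxfun] picks, [P *m invmx Q] intertwines it with the frame, so the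
    choice does not matter. *)
Lemma frame_mxfun m n (A : 'M[R]_n) (P : 'M[R]_(m, n)) (d : 'rV[R]_m) (f : R -> R) :
  P^T *m P = 1%:M -> P *m A = diag_mx d *m P ->
  P *m mxfun f A = diag_mx (map_mx f d) *m P.
Proof.
move=> PP PA; rewrite /mxfun; case: xgetP => [B _ [Q [e [Qu eA ->]]]|none].
  have QA : Q *m A = diag_mx e *m Q by rewrite eA -!mulmxA mulKVmx.
  have h : P *m invmx Q *m diag_mx e = diag_mx d *m (P *m invmx Q).
    by rewrite mulmxA -PA -!mulmxA; congr (_ *m _); rewrite eA mulmxK ?mulKmx // -mulmxA.
  by rewrite !mulmxA (intertwine_map f h) -!mulmxA mulVmx // mulmx1.
(* It remains to exclude the default value of [xget]: [n] independent rows of [P] form an invertible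
   matrix of eigenvectors. *)
have Pf : row_full P by apply/row_fullP; exists P^T.
pose g := fullrankfun Pf; pose Q := rowsub g P; pose e := colsub g d.
have Qu : Q \in unitmx := fullrowsub_unit Pf.
case: (none (invmx Q *m diag_mx (map_mx f e) *m Q)); exists Q, e; split=> //.
rewrite -mulmxA; apply: (canRL (mulKmx Qu)).
apply/matrixP => i j; have /matrixP/(_ (g i) j) := PA.
by rewrite !mul_diag_mx !mxE => <-; apply: eq_bigr => k _; rewrite !mxE.
Qed.

End Spectral.

(** * Maximum principle *)

Section Comparison.
Variable R : realType.

Lemma is_derive_lt0_left (f : R -> R) (t df a : R) : is_derive t 1 f df -> df < 0 -> a < t ->
  exists2 x, a < x < t & f t < f x.
Proof.
move=> [fd fdf] df0 at0; have := fd; rewrite /derivable -/(derive f t 1).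
move=> /cvg_ex[l hl]; have el : l = df.
  by rewrite -fdf /derive; apply/esym; apply: cvg_lim hl.
move: hl; rewrite el => hl.
have := cvgr_lt df hl 0 df0; rewrite near_withinE => /(_ _).
move=> /nbhs_ballP[e /= e0 He].
pose k := Num.min (e / 2) ((t - a) / 2).
have k0 : 0 < k by rewrite /k lt_min !divr_gt0 ?subr_gt0.
have ke : k < e by rewrite /k gt_min; apply/orP; left; lra.
have ka : k < t - a by rewrite /k gt_min; apply/orP; right; lra.
exists (t - k); first by apply/andP; split; lra.
have := He (- k); rewrite /ball /= sub0r opprK gtr0_norm // oppr_eq0 gt_eqF //.
move=> /(_ ke isT); rewrite /GRing.scale /= mulr1 => h.
have : (- k)^-1 * (f (- k + t) - f t) * k < 0 by rewrite pmulr_llt0.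
have -> : (- k)^-1 * (f (- k + t) - f t) * k = f t - f (- k + t).
  by field; rewrite gt_eqF.
by rewrite subr_lt0 addrC.
Qed.

(** A weighted graph Laplacian, with the sign that makes it positive semidefinite. *)
Definition generator n (D : 'M[R]_n) :=
  [/\ D^T = D, forall i j, i != j -> D i j <= 0 & forall i, \sum_j D i j = 0].

Lemma generator_max n (D : 'M[R]_n) (v : 'I_n -> R) l : generator D ->
  (forall m, v m <= v l) -> 0 <= \sum_m D l m * v m.
Proof.
move=> [_ D0 Ds] vl; have -> : \sum_m D l m * v m = \sum_m D l m * (v m - v l).
  under [RHS]eq_bigr do rewrite mulrBr.
  by rewrite sumrB -mulr_suml Ds mul0r subr0.
apply: sumr_ge0 => m _; have [->|ml] := eqVneq m l; first by rewrite subrr mulr0.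
by rewrite mulr_le0 ?subr_le0 // D0 // eq_sym.
Qed.

(** If the bound failed, take the largest value over all components and times. It is attained at a
    positive time, where the coupling and [S v > S beta] make the derivative negative; then a larger
    value occurs just before. *)
Lemma comparison n (D : 'M[R]_n) (S beta T : R) (v g : 'I_n -> R -> R) :
  generator D -> 0 < S ->
  (forall l (t : R), is_derive t 1 (v l) (g l t - S * v l t - \sum_m D l m * v m t)) ->
  (forall l t, 0 <= t <= T -> g l t <= S * beta) ->
  (forall l, v l 0 <= beta) -> forall l t, 0 <= t <= T -> v l t <= beta.
Proof.
move=> gD S0 hv hg h0 l0 t0 /andP[t00 t0T]; rewrite leNgt; apply/negP => hl0.
have T0 : 0 <= T by apply: le_trans t0T.
(* First the best time for each component, then the best component. *)
have /choice[c hc] l : exists c, 0 <= c <= T /\ forall t, 0 <= t <= T -> v l t <= v l c.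
  have [c] := @EVT_max R (v l) 0 T T0
   (derivable_within_continuous (fun z _ => @ex_derive _ _ _ _ _ _ _ (hv l z))).
  by rewrite in_itv /= => hc1 hc2; exists c; split=> // t ht; apply: hc2; rewrite in_itv.
pose l := [arg max_(l > l0) v l (c l)]%O.
have hl m : v m (c m) <= v l (c l) by rewrite /l; case: arg_maxP => //= i _; apply.
have [/andP[c0 cT] cmax] := hc l.
have vb : beta < v l (c l).
  by apply: lt_le_trans (hl l0); apply: lt_le_trans hl0 _; apply: (hc l0).2; rewrite t00.
have cp : 0 < c l.
  rewrite lt_def c0 andbT; apply: contraTneq vb => ->; rewrite -leNgt; exact: h0.
have d0 : g l (c l) - S * v l (c l) - \sum_m D l m * v m (c l) < 0.
  have := @generator_max n D (fun m => v m (c l)) l gD.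
  have hm m : v m (c l) <= v l (c l).
    by apply: le_trans (hl m); apply: (hc m).2; rewrite c0.
  move=> /(_ hm) hs; have := hg l (c l); rewrite c0 cT => /(_ isT).
  have : S * beta < S * v l (c l) by rewrite ltr_pM2l.
  lra.
have [x /andP[x0 xc] hx] := is_derive_lt0_left (hv l (c l)) d0 cp.
by have := cmax x; rewrite (ltW x0) (ltW (lt_le_trans xc cT)) leNgt hx => /(_ isT).
Qed.
End Comparison.

(** * Frame coordinates and the exact linear flow *)

Section Frame.
Variable R : realType.

Definition dot n (a b : 'cV[R]_n) : R := \sum_l a l 0 * b l 0.

(** Summation by parts: by symmetry and zero row sums, twice the form is the sum of
    [- D l m * (a l - a m) * (b l - b m)]. *)
Lemma generator_form n (D : 'M[R]_n) (a b : 'cV[R]_n) : generator D ->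
  (forall l m, 0 <= (a l 0 - a m 0) * (b l 0 - b m 0)) -> 0 <= dot a (D *m b).
Proof.
move=> [Dt D0 Ds] ab.
have sD l m : D l m = D m l by have /matrixP/(_ m l) := Dt; rewrite mxE.
have e1 : dot a (D *m b) = \sum_l \sum_m D l m * (a l 0 * (b m 0 - b l 0)).
  apply: eq_bigr => l _; rewrite mxE.
  transitivity (a l 0 * (\sum_j D l j * b j 0) - a l 0 * b l 0 * \sum_j D l j).
    by rewrite Ds mulr0 subr0.
  rewrite !mulr_sumr -sumrB.
  by apply: eq_bigr => m _; ring.
have e2 : dot a (D *m b) = \sum_l \sum_m D l m * (a m 0 * (b l 0 - b m 0)).
  rewrite e1 exchange_big /=; apply: eq_bigr => l _; apply: eq_bigr => m _.
  by rewrite sD.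
suff : 0 <= dot a (D *m b) + dot a (D *m b) by lra.
rewrite {1}e1 e2 -big_split /=; apply: sumr_ge0 => l _; rewrite -big_split /=.
apply: sumr_ge0 => m _.
have -> : D l m * (a l 0 * (b m 0 - b l 0)) + D l m * (a m 0 * (b l 0 - b m 0))
  = - D l m * ((a l 0 - a m 0) * (b l 0 - b m 0)) by ring.
have [->|lm] := eqVneq l m; first by rewrite !subrr !mulr0.
by rewrite mulr_ge0 // oppr_ge0 D0.
Qed.

Lemma generator_psd n (D : 'M[R]_n) (a : 'cV[R]_n) : generator D -> 0 <= dot a (D *m a).
Proof. by move=> gD; apply: generator_form => // l m; rewrite -expr2 sqr_ge0. Qed.

Definition frame m n (L : 'M[R]_n) (S : R) (P : 'M[R]_(m, n)) (ell : 'I_m -> R) :=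
  [/\ P^T *m P = 1%:M, P *m L = diag_mx (\row_j ell j) *m P & forall j, S <= ell j].

Lemma generator_frame n (D : 'M[R]_n) (S : R) : generator D ->
  exists m (P : 'M[R]_(m, n)) ell, frame (D + S%:M) S P ell.
Proof.
move=> gD; have [Dt D0 Ds] := gD.
have Ls : (D + S%:M)^T = D + S%:M by rewrite linearD /= tr_scalar_mx Dt.
have [P [d [PP PL]]] := symmetric_frame Ls.
(* Rows of [P] may vanish, and then [d 0 j] is arbitrary. *)
exists (n + n)%N, P, (fun j => if row j P == 0 then S else d 0 j); split=> // [|j].
  rewrite PL; apply/matrixP => j l; rewrite !mul_diag_mx !mxE.
  case: ifP => // /eqP/rowP/(_ l); rewrite !mxE => ->.
  by rewrite !mulr0.
case: ifPn => // r0.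
pose a := (row j P)^T.
have ea : D *m a = (d 0 j - S) *: a.
  apply/trmx_inj; rewrite trmx_mul /a trmxK Dt linearZ /= trmxK.
  apply/rowP => l; have /matrixP/(_ j l) := PL; rewrite mulmxDr mul_mx_scalar mul_diag_mx.
  rewrite -row_mul !mxE => h; rewrite mulrBl -h; ring.
have da : dot a a != 0.
  apply: contraNneq r0 => h; apply/eqP/rowP => l; rewrite [RHS]mxE.
  have /psumr_eq0P := h; move=> /(_ _ l isT); rewrite /a !mxE.
  have hh : forall i : 'I_n, true -> 0 <= (row j P)^T i 0 * (row j P)^T i 0.
    by move=> i _; rewrite -expr2 sqr_ge0.
  by move=> /(_ hh)/eqP; rewrite mulf_eq0 orbb => /eqP.
have dp : 0 < dot a a.
  by rewrite lt_def da; apply: sumr_ge0 => l _; rewrite -expr2 sqr_ge0.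
have := generator_psd a gD; rewrite ea.
have -> : dot a ((d 0 j - S) *: a) = (d 0 j - S) * dot a a.
  by rewrite /dot mulr_sumr; apply: eq_bigr => l _; rewrite !mxE; ring.
by rewrite pmulr_lge0 // subr_ge0.
Qed.

Section InFrame.
Variables (m n : nat) (D : 'M[R]_n) (S : R) (P : 'M[R]_(m, n)) (ell : 'I_m -> R).
Hypothesis fP : frame (D + S%:M) S P ell.
Hypothesis gD : generator D.
Hypothesis S_gt0 : 0 < S.
Local Notation hat a j := ((P *m a) j 0).

Lemma ell_gt0 j : 0 < ell j.
Proof. by have [_ _ h] := fP; apply: lt_le_trans (h j). Qed.

Lemma dot_hat (a b : 'cV[R]_n) : dot a b = \sum_j hat a j * hat b j.
Proof.
have [PP _ _] := fP.
have -> : dot a b = (a^T *m b) 0 0 by rewrite mxE; apply: eq_bigr => l _; rewrite mxE.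
rewrite -[b in LHS]mul1mx -PP -mulmxA mulmxA -trmx_mul mxE.
by apply: eq_bigr => j _; rewrite mxE.
Qed.

Lemma hat_D (a : 'cV[R]_n) j : hat (D *m a) j = (ell j - S) * hat a j.
Proof.
have -> : D = (D + S%:M) - S%:M by rewrite addrK.
rewrite mulmxBl mulmxBr mul_scalar_mx -scalemxAr mulmxA.
rewrite mxE [X in _ + X]mxE [X in _ - X]mxE.
have -> : (P *m (D + S%:M) *m a) j 0 = ell j * hat a j.
  by have [_ -> _] := fP; rewrite -mulmxA mul_diag_mx !mxE.
by rewrite mulrBl.
Qed.

Lemma hat_L (a : 'cV[R]_n) j : hat ((D + S%:M) *m a) j = ell j * hat a j.
Proof. by have [_ PL _] := fP; rewrite mulmxA PL -mulmxA mul_diag_mx !mxE. Qed.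

Lemma hat_mxfun (f : R -> R) (dt : R) (a : 'cV[R]_n) j :
  hat (mxfun f (dt *: (D + S%:M)) *m a) j = f (dt * ell j) * hat a j.
Proof.
have [PP PL _] := fP.
have PA : P *m (dt *: (D + S%:M)) = diag_mx (\row_j (dt * ell j)) *m P.
  rewrite -scalemxAr PL; apply/matrixP => i l; rewrite mxE !mul_diag_mx !mxE; ring.
by rewrite mulmxA (frame_mxfun f PP PA) -mulmxA mul_diag_mx !mxE.
Qed.

Lemma hat_inv (a : 'cV[R]_n) l : a l 0 = \sum_j P j l * hat a j.
Proof.
have [PP _ _] := fP; rewrite -[a in LHS]mul1mx -PP -mulmxA mxE.
by apply: eq_bigr => j _; rewrite mxE.
Qed.

Lemma hat_eq0 (a : 'cV[R]_n) : (forall j, hat a j = 0) -> a = 0.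
Proof.
move=> h; apply/colP => l; rewrite hat_inv mxE big1 // => j _.
by rewrite h mulr0.
Qed.

Lemma etd_upper_bound (dt b : R) (u n0 z : 'cV[R]_n) : 0 < dt ->
  (forall l, u l 0 <= b) -> (forall l, n0 l 0 <= S * b) ->
  (forall l, n0 l 0 + z l 0 <= S * b) ->
  forall l, (mxfun (@phi0 R) (dt *: (D + S%:M)) *m u
    + dt *: (mxfun (@phi1 R) (dt *: (D + S%:M)) *m n0)
    + dt *: (mxfun (@phi2 R) (dt *: (D + S%:M)) *m z)) l 0 <= b.
Proof.
move=> dt0 hu hn hz l.
(* The left-hand side is [v dt], where [v' = - L v + n0 + (t / dt) z], [v 0 = u]. *)
pose c j (t : R) := expR (- (ell j * t)) * hat u j
  + (1 - expR (- (ell j * t))) / ell j * hat n0 j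
  + (expR (- (ell j * t)) - 1 + ell j * t) / (ell j ^+ 2 * dt) * hat z j.
have c' j (t : R) : is_derive t 1 (c j) (- (ell j * c j t) + hat n0 j + t / dt * hat z j).
  have e0 := ell_gt0 j.
  rewrite /c; apply: is_derive_eq; rewrite /GRing.scale /=.
  by field; rewrite !gt_eqF.
pose v i (t : R) := \sum_j P j i * c j t.
have vE i (t : R) : is_derive t 1 (v i)
   (n0 i 0 + t / dt * z i 0 - S * v i t - \sum_k D i k * v k t).
  have ev : \sum_j (fun t => P j i * c j t) = v i.
    by apply/funext => w; rewrite fct_sumE.
  have dP j : is_derive t 1 (fun t => P j i * c j t)
      (P j i * (- (ell j * c j t) + hat n0 j + t / dt * hat z j)).
    apply: is_derive_eq; rewrite /GRing.scale /=; ring.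
  have ds := @is_derive_sum _ _ _ _ _ t 1 _ dP.
  rewrite ev in ds; apply: (is_derive_eq ds).
  have -> : \sum_k D i k * v k t = \sum_j P j i * ((ell j - S) * c j t).
    transitivity (\sum_k \sum_j D i k * (P j k * c j t)).
      by apply: eq_bigr => k _; rewrite /v mulr_sumr.
    rewrite exchange_big /=; apply: eq_bigr => j _.
    have [_ /matrixP/(_ j i) + _] := fP.
    rewrite mulmxDr mul_mx_scalar mul_diag_mx !mxE => h.
    transitivity ((\sum_k P j k * D k i) * c j t); last first.
      by rewrite mulrA mulrBr -[P j i * ell j]mulrC -h; ring.
    rewrite mulr_suml; apply: eq_bigr => k _.
    have [/matrixP/(_ i k) + _ _] := gD; rewrite mxE => ->; ring.
  rewrite (hat_inv n0) (hat_inv z) /v !mulr_sumr -!big_split -!sumrB /=.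
  by apply: eq_bigr => j _; ring.
have v0 i : v i 0 = u i 0.
  rewrite hat_inv; apply: eq_bigr => j _; rewrite /c.
  by rewrite mulr0 oppr0 expR0 subrr !addr0 !mul0r !addr0 mul1r.
have vdt i : v i dt = (mxfun (@phi0 R) (dt *: (D + S%:M)) *m u
    + dt *: (mxfun (@phi1 R) (dt *: (D + S%:M)) *m n0)
    + dt *: (mxfun (@phi2 R) (dt *: (D + S%:M)) *m z)) i 0.
  rewrite [RHS]hat_inv; apply: eq_bigr => j _; congr (_ * _).
  rewrite !mulmxDr -!scalemxAr [RHS]mxE [X in _ = X + _]mxE.
  rewrite [X in _ = _ + X + _]mxE [X in _ = _ + _ + X]mxE !hat_mxfun.
  rewrite /c /phi0 /phi1 /phi2 [ell j * dt]mulrC.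
  by have := ell_gt0 j => e0; field; rewrite !gt_eqF.
rewrite -vdt; have cmp := @comparison R n D S b dt v _ gD S_gt0 vE.
apply: cmp => [i t /andP[t0 t1]|i|].
(* The forcing at time [t] is a convex combination of its end values [n0] and [n0 + z]. *)
- have t2 : t / dt <= 1 by rewrite ler_pdivrMr // mul1r.
  have t3 : 0 <= t / dt by rewrite divr_ge0 // ltW.
  have : (1 - t / dt) * n0 i 0 <= (1 - t / dt) * (S * b).
    by rewrite ler_wpM2l // subr_ge0.
  have : t / dt * (n0 i 0 + z i 0) <= t / dt * (S * b) by rewrite ler_wpM2l.
  lra.
- by rewrite v0.
- by rewrite lexx ltW.
Qed.

End InFrame.
End Frame.

(** * The Neumann Laplacian as a generator *)

Section Laplacian.
Variable R : realType.

Lemma LambdaE M (i j : 'I_M) : Lambda R M i j =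
  (i.+1 == j :> nat)%:R + (j.+1 == i :> nat)%:R
  - (i == j)%:R * ((0 < i)%N%:R + (i.+1 < M)%N%:R).
Proof.
rewrite mxE; have [->|ij] := eqVneq i j.
  rewrite mul1r (_ : (j.+1 == j :> nat) = false) ?addr0 ?sub0r //; lia.
rewrite mul0r subr0; have [e|_] := eqVneq (nat_of_ord i).+1 j; last first.
  by rewrite add0r /=; case: (_ == _).
by rewrite (_ : (j.+1 == i :> nat) = false) ?addr0 //; lia.
Qed.

Lemma Lambda_sym M : (Lambda R M)^T = Lambda R M.
Proof.
apply/matrixP => i j; rewrite mxE !LambdaE [j == i]eq_sym.
case: (eqVneq i j) => [->//|_].
by rewrite !mul0r !subr0 addrC.
Qed.

Lemma Lambda_offdiag M (i j : 'I_M) : i != j -> 0 <= Lambda R M i j.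
Proof. by move=> ij; rewrite mxE (negbTE ij); case: ifP. Qed.

Let sum_eq_ord M k : \sum_(j < M) (k == j :> nat)%:R = (k < M)%N%:R :> R.
Proof.
have [kM|kM] := ltnP k M; last first.
  by rewrite big1 // => j _; rewrite (_ : _ == _ = false) //; have := ltn_ord j; lia.
rewrite (bigD1 (Ordinal kM)) //= eqxx big1 ?addr0 // => j jk.
rewrite (_ : _ == _ = false) //; apply: contraNF jk => /eqP e; apply/eqP/val_inj.
by rewrite /= e.
Qed.

Lemma Lambda_row M (i : 'I_M) : \sum_j Lambda R M i j = 0.
Proof.
under eq_bigr do rewrite LambdaE.
rewrite sumrB big_split /= sum_eq_ord -mulr_suml.
rewrite (_ : \sum_(j < M) (j.+1 == i :> nat)%:R = (0 < i)%N%:R); last first.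
  have [i0|i0] := posnP i; first by rewrite big1 // => j _; rewrite i0.
  rewrite (eq_bigr (fun j : 'I_M => (i.-1 == j :> nat)%:R)); last first.
    by move=> j _; congr (_%:R); congr nat_of_bool; lia.
  by rewrite sum_eq_ord (_ : (i.-1 < M)%N) //; have := ltn_ord i; lia.
rewrite (_ : \sum_j (i == j)%:R = 1) ?mul1r; first by ring.
by rewrite (bigD1 i) //= eqxx big1 ?addr0 // => j; rewrite eq_sym => /negbTE ->.
Qed.

Lemma Dh_generator M1 M2 (eps h : R) : 0 <= eps ->
  generator (- (2 * eps) *: Dh M1 M2 h).
Proof.
move=> e0.
have c0 : 0 <= 2 * eps * (h ^+ 2)^-1 by rewrite !mulr_ge0 // invr_ge0 sqr_ge0.
pose B := 1%:M *t Lambda R M1 + Lambda R M2 *t 1%:M : 'M[R]_(M2 * M1).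
have -> : - (2 * eps) *: Dh M1 M2 h = - ((2 * eps * (h ^+ 2)^-1) *: B).
  by rewrite /Dh scalerA mulNr scaleNr.
split.
- by rewrite linearN linearZ /= /B linearD /= !trmx_tens !Lambda_sym !trmx1.
- move=> i j ij; rewrite mxE oppr_le0 mxE mulr_ge0 //.
  case: (mxtens_indexP i) ij => i2 i1; case: (mxtens_indexP j) => j2 j1 ij.
  rewrite mxE !tensmxE !mxE.
  (* Off the diagonal at least one index component differs, so at most one of the two Kronecker
     terms is nonzero. *)
  have [e2|n2] := eqVneq i2 j2.
    have n1 : i1 != j1 by apply: contraNneq ij => ->; rewrite e2.
    rewrite (negbTE n1) /= mulr0 addr0 mul1r.
    by have := Lambda_offdiag n1; rewrite mxE (negbTE n1).
  rewrite mul0r add0r; have := Lambda_offdiag n2; rewrite mxE (negbTE n2) => l0.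
  by rewrite mulr_ge0.
- move=> i; transitivity (- (2 * eps * (h ^+ 2)^-1 * \sum_j B i j)).
    by rewrite mulr_sumr -sumrN; apply: eq_bigr => j _; rewrite !mxE.
  suff -> : \sum_j B i j = 0 by rewrite mulr0 oppr0.
  transitivity (\sum_j (1%:M *t Lambda R M1) i j + \sum_j (Lambda R M2 *t 1%:M) i j).
    by rewrite -big_split; apply: eq_bigr => j _; rewrite mxE.
  have tens_row (A : 'M[R]_M2) (A' : 'M[R]_M1) : \sum_j (A *t A') i j =
      (\sum_j A (mxtens_unindex i).1 j) * (\sum_j A' (mxtens_unindex i).2 j).
    by rewrite mulr_sum; apply: eq_bigr => j _; rewrite mxE.
  by rewrite !tens_row !Lambda_row mulr0 mul0r addr0.
Qed.
End Laplacian.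

(** * The fidelity term *)

Section Heaviside.
Variable R : realType.
Variable e : R.
Hypothesis e_gt0 : 0 < e.
Implicit Types x y u : R.

(* [heaviside] and its derivative [delta] are [k] and [k'] after clamping. *)
Let k u : R := (2 * e)^-1 * (u + e / pi * sin (pi * u / e)) + 2^-1.
Let k' u : R := (2 * e)^-1 * (1 + cos (pi * u / e)).
Let clamp u : R := Num.max (- e) (Num.min u e).

Let clampP u : [\/ clamp u = u /\ `|u| <= e, clamp u = e /\ e < u | clamp u = - e /\ u < - e].
Proof.
have e0 := e_gt0; rewrite /clamp; have [h|h] := leP u e; have [h'|h'] := leP (- e) u.
- by apply: Or31; rewrite ler_norml h h'.
- by apply: Or33.
- by apply: Or32; split=> //; apply/max_idPr; lra.
- by exfalso; lra.
Qed.

Let is_derive_k (u : R) : is_derive u 1 k (k' u).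
Proof.
have p0 := pi_gt0 R; rewrite /k /k'; apply: is_derive_eq; rewrite /GRing.scale /=.
by move: p0; move: pi => q q0; field; rewrite !gt_eqF.
Qed.

Let k'_ge0 u : 0 <= k' u.
Proof.
rewrite /k' mulr_ge0 ?invr_ge0 ?mulr_ge0 ?(ltW e_gt0) //.
Qed.

Let k'_le u : k' u <= e^-1.
Proof.
have -> : e^-1 = (2 * e)^-1 * 2 by field; rewrite gt_eqF.
rewrite /k' ler_wpM2l ?invr_ge0 ?mulr_ge0 ?(ltW e_gt0) //.
by have := cos_le1 (pi * u / e); lra.
Qed.

Let is_derive_k' (u : R) : is_derive u 1 k' (- (pi / (2 * e ^+ 2)) * sin (pi * u / e)).
Proof.
rewrite /k'; apply: is_derive_eq; rewrite /GRing.scale /=.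
by move: pi => q; field; rewrite !gt_eqF.
Qed.

Let C : R := pi / (2 * e ^+ 2).
Let C_ge0 : 0 <= C.
Proof. by rewrite divr_ge0 ?mulr_ge0 ?sqr_ge0 // ltW // pi_gt0. Qed.

Let lip_of_derive (f df : R -> R) (c x y : R) : (forall z : R, is_derive z 1 f (df z)) ->
  (forall z, `|df z| <= c) -> `|f y - f x| <= c * `|y - x|.
Proof.
move=> hf hc; wlog xy : x y / x <= y.
  move=> hw; have [|/ltW yx] := leP x y; first exact: hw.
  by rewrite distrC [`|y - x|]distrC; apply: hw.
have [z _ ->] := is_derive_mean hf xy.
by rewrite normrM ler_wpM2r.
Qed.

Let k'_lip x y : `|k' y - k' x| <= C * `|y - x|.
Proof.
apply: (lip_of_derive _ _ is_derive_k') => z; rewrite -/C normrM normrN (ger0_norm C_ge0).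
by rewrite ler_piMr // ler_norml sin_geN1 sin_le1.
Qed.

Let ke : k e = 1.
Proof.
by rewrite /k mulfK ?gt_eqF // sinpi mulr0 addr0; field; rewrite gt_eqF.
Qed.

Let kNe : k (- e) = 0.
Proof.
rewrite /k mulrN mulNr mulfK ?gt_eqF // sinN sinpi oppr0 mulr0 addr0.
by field; rewrite gt_eqF.
Qed.

Let heavisideE u : heaviside e u = k (clamp u).
Proof.
have e0 := e_gt0; rewrite /heaviside -/(k u).
case: (clampP u) => [[-> h]|[-> h]|[-> h]].
- by rewrite h.
- have -> : `|u| <= e = false by apply/negbTE; rewrite -ltNge lter_normr h.
  by rewrite h ke.
- have -> : `|u| <= e = false by apply/negbTE; rewrite -ltNge lter_normr ltrNr h orbT.
  by rewrite kNe (_ : e < u = false) //; apply/negbTE; rewrite -leNgt; lra.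
Qed.

Let k'e : k' e = 0.
Proof. by rewrite /k' mulfK ?gt_eqF // cospi addrN mulr0. Qed.

Let k'Ne : k' (- e) = 0.
Proof. by rewrite /k' mulrN mulNr cosN -/(k' e) k'e. Qed.

Let deltaE u : delta e u = k' (clamp u).
Proof.
rewrite /delta; case: (clampP u) => [[-> h]|[-> h]|[-> h]].
- by rewrite h.
- have -> : `|u| <= e = false by apply/negbTE; rewrite -ltNge lter_normr h.
  by rewrite k'e.
- have -> : `|u| <= e = false by apply/negbTE; rewrite -ltNge lter_normr ltrNr h orbT.
  by rewrite k'Ne.
Qed.

Lemma delta0 u : e <= `|u| -> delta e u = 0.
Proof.
move=> h; rewrite deltaE; case: (clampP u) => [[-> h']|[-> _]|[-> _]] //.
have : `|u| = e by apply/eqP; rewrite eq_le h h'.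
have [u0|u0] := leP 0 u; first by rewrite ger0_norm // => ->.
by rewrite ltr0_norm // => /(congr1 -%R); rewrite opprK => ->.
Qed.

Lemma delta_ge0 u : 0 <= delta e u. Proof. by rewrite deltaE. Qed.
Lemma delta_le u : delta e u <= e^-1. Proof. by rewrite deltaE. Qed.

Lemma heaviside01 u : 0 <= heaviside e u <= 1.
Proof.
rewrite /heaviside; case: ifPn => [|_]; last by case: ifP; rewrite ?lexx ?ler01.
rewrite ler_norml => /andP[u1 u2]; rewrite -/(k u).
have dk := @is_derive_ge0_le R k k'.
by apply/andP; split; [rewrite -kNe|rewrite -ke]; apply: dk.
Qed.

(** Both [clamp u] and [u - clamp u] are nondecreasing in [u], so their increments have the same
    sign. *)
Let clamp_dist x y :
  `|clamp y - clamp x| + `|(y - clamp y) - (x - clamp x)| = `|y - x|.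
Proof.
have e0 := e_gt0.
wlog xy : x y / x <= y.
  move=> hw; have [|/ltW yx] := leP x y; first exact: hw.
  by rewrite distrC [X in _ + X]distrC [RHS]distrC; apply: hw.
have c1 : 0 <= clamp y - clamp x.
  by case: (clampP x) (clampP y); move=> [-> +] [][-> +]; rewrite ?ler_norml; lra.
have c2 : 0 <= (y - clamp y) - (x - clamp x).
  by case: (clampP x) (clampP y); move=> [-> +] [][-> +]; rewrite ?ler_norml; lra.
by rewrite (ger0_norm c1) (ger0_norm c2) ger0_norm ?subr_ge0 //; ring.
Qed.

Lemma heaviside_lip x y : `|heaviside e y - heaviside e x| <= e^-1 * `|y - x|.
Proof.
rewrite !heavisideE; apply: le_trans (lip_of_derive _ _ is_derive_k _) _.
  by move=> z; rewrite ger0_norm.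
rewrite ler_wpM2l ?invr_ge0 ?(ltW e_gt0) // -[leRHS]clamp_dist.
by rewrite lerDl.
Qed.

Lemma heaviside_bregman x y :
  `|heaviside e y - heaviside e x - delta e x * (y - x)| <= pi / (2 * e ^+ 2) * (y - x) ^+ 2.
Proof.
rewrite !heavisideE deltaE -/C.
set X := clamp x; set Y := clamp y.
pose c' := (y - Y) - (x - X).
(* If [c'] is nonzero, one of the two points was clamped, and [k'] vanishes there; the Lipschitz
   bound on [k'] does the rest. *)
have key : `|k' X * c'| <= C * `|Y - X| * `|c'|.
  have [->|cn] := eqVneq c' 0; first by rewrite mulr0 normr0 mulr0.
  rewrite normrM ler_wpM2r //.
  have [X0|Y0] : k' X = 0 \/ k' Y = 0.
    move: cn; rewrite /c' /X /Y.
    case: (clampP x) => [[-> _]|[-> _]|[-> _]] cn; rewrite ?k'e ?k'Ne; [right|by left|by left].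
    move: cn; case: (clampP y) => [[-> _]|[-> _]|[-> _]] //.
    by rewrite !subrr eqxx.
  - by rewrite X0 normr0 mulr_ge0.
  - by rewrite -[k' X]subr0 -Y0 distrC.
have [z hz ->] : exists2 z, `|z - X| <= `|Y - X| & k Y - k X = k' z * (Y - X).
  have [XY|/ltW YX] := leP X Y.
    have [z /andP[z1 z2] ez] := is_derive_mean is_derive_k XY; exists z => //.
    by rewrite !ger0_norm ?subr_ge0 // lerB.
  have [z /andP[z1 z2] ez] := is_derive_mean is_derive_k YX; exists z.
    by rewrite !ler0_norm ?subr_le0 // lerN2 lerB.
  by rewrite -opprB ez -mulrN opprB.
have -> : k' z * (Y - X) - k' X * (y - x) = (k' z - k' X) * (Y - X) - k' X * c'.
  by rewrite /c'; ring.
apply: le_trans (ler_normB _ _) _; rewrite -(real_normK (num_real (y - x))).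
have <- := clamp_dist x y; rewrite -/X -/Y -/c' normrM.
have h1 : `|k' z - k' X| * `|Y - X| <= C * `|Y - X| * `|Y - X|.
  by rewrite ler_wpM2r // (le_trans (k'_lip _ _)) // ler_wpM2l.
have h2 : 0 <= C * (`|Y - X| * `|c'|) by apply: mulr_ge0 => //; rewrite mulr_ge0.
have h3 : 0 <= C * (`|c'| ^+ 2) by apply: mulr_ge0 => //; rewrite sqr_ge0.
lra.
Qed.

End Heaviside.

Section Fidelity.
Variables (R : realType) (om : nat) (lam e sg : R).
Hypothesis lam_gt0 : 0 < lam.
Hypothesis e_gt0 : 0 < e.
Hypothesis e_le : e <= 6^-1.
Hypothesis sg_ge : om%:R * lam * pi / e ^+ 2 <= sg.
Variables (px : 'I_om -> R) (C : intensities R om).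
Hypothesis px01 : forall r, 0 <= px r <= 1.
Hypothesis C01 : forall a b r, 0 <= C a b r <= 1.
Implicit Types u v : R.

Let A01 a b r : 0 <= fidelity px C a b r <= 1.
Proof.
rewrite /fidelity sqr_ge0 /=; have /andP[p0 p1] := px01 r; have /andP[c0 c1] := C01 a b r.
by nra.
Qed.

Let sum_le (f : 'I_om -> R) b : (forall r, f r <= b) -> \sum_r f r <= om%:R * b.
Proof.
move=> h; apply: le_trans (ler_sum _ (fun r _ => h r)) _.
by rewrite sumr_const card_ord mulr_natl.
Qed.

Let weighted_le (a b t : R) : -1 <= a <= 1 -> -1 <= b <= 1 -> 0 <= t <= 1 ->
  `|a * t + b * (1 - t)| <= 1.
Proof. by move=> /andP[? ?] /andP[? ?] /andP[? ?]; rewrite ler_norml; nra. Qed.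

Let diff_fid a b a' b' r : -1 <= fidelity px C a b r - fidelity px C a' b' r <= 1.
Proof. by have /andP[? ?] := A01 a b r; have /andP[? ?] := A01 a' b' r; lra. Qed.

(** Since [e <= 1 / 6] and [pi >= 2], the ratio [e / pi] is at most [1 / 12]. *)
Let ome : om%:R * (lam * e^-1) <= sg / 12.
Proof.
have p0 := pi_gt0 R; have p2 := pi_ge2 R; have e0 := e_gt0; have l0 := lam_gt0.
have -> : om%:R * (lam * e^-1) = (om%:R * lam * pi / e ^+ 2) * (e / pi).
  by move: p0; move: pi => q q0; field; rewrite !gt_eqF.
have h : 0 <= om%:R * lam * pi / e ^+ 2.
  by rewrite divr_ge0 ?sqr_ge0 // !mulr_ge0 ?(ltW l0) ?(ltW p0).
have : e / pi <= 12^-1.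
  by rewrite ler_pdivrMr //; have := e_le; lra.
move=> h'; apply: le_trans (ler_wpM2l h h') _.
by rewrite ler_wpM2r // invr_ge0.
Qed.

Let force_le (P : 'I_om -> R) d : (forall r, `|P r| <= 1) -> 0 <= d <= e^-1 ->
  `|lam * \sum_r (P r * d)| <= sg / 12.
Proof.
move=> hP /andP[d0 d1]; apply: le_trans ome.
rewrite normrM (gtr0_norm lam_gt0) [leRHS]mulrCA ler_pM2l //.
apply: le_trans (ler_norm_sum _ _ _) _; apply: sum_le => r.
by rewrite normrM (ger0_norm d0) (le_trans (ler_piMl _ (hP r))).
Qed.

Lemma f1_le u1 u2 : `|f1 lam e u1 u2 px C| <= sg / 12.
Proof.
apply: force_le => [r|]; last by rewrite delta_ge0 // delta_le.
by apply: weighted_le; rewrite ?diff_fid ?heaviside01.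
Qed.

Lemma f2_le u1 u2 : `|f2 lam e u1 u2 px C| <= sg / 12.
Proof.
apply: force_le => [r|]; last by rewrite delta_ge0 // delta_le.
by apply: weighted_le; rewrite ?diff_fid ?heaviside01.
Qed.

Lemma f1_eq0 u1 u2 : 6^-1 <= `|u1 - 2^-1| -> f1 lam e u1 u2 px C = 0.
Proof.
move=> h; rewrite /f1 (delta0 e_gt0 (le_trans e_le h)).
by rewrite big1 ?mulr0 // => r _; rewrite mulr0.
Qed.

Lemma f2_eq0 u1 u2 : 6^-1 <= `|u2 - 2^-1| -> f2 lam e u1 u2 px C = 0.
Proof.
move=> h; rewrite /f2 (delta0 e_gt0 (le_trans e_le h)).
by rewrite big1 ?mulr0 // => r _; rewrite mulr0.
Qed.

(** [F] is affine in each of the two Heaviside values, so its remainder is a combination of their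
    two remainders, with coefficients at most 1, and of the mixed product, with coefficient at most
    2. The total [pi / 2 + 1] is at most [pi]. *)
Lemma F_bregman u1 u2 v1 v2 :
  F lam e v1 v2 px C - F lam e u1 u2 px C
    - f1 lam e u1 u2 px C * (v1 - u1) - f2 lam e u1 u2 px C * (v2 - u2)
  <= sg * ((v1 - u1) ^+ 2 + (v2 - u2) ^+ 2).
Proof.
have p0 := pi_gt0 R; have p2 := pi_ge2 R; have e0 := e_gt0; have l0 := lam_gt0.
set d1 := v1 - u1; set d2 := v2 - u2.
pose H x := heaviside e (x - 2^-1); pose dl x := delta e (x - 2^-1).
have B1 : `|H v1 - H u1 - dl u1 * d1| <= pi / (2 * e ^+ 2) * d1 ^+ 2.
  by have := heaviside_bregman e0 (u1 - 2^-1) (v1 - 2^-1); rewrite opprB addrA subrK.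
have B2 : `|H v2 - H u2 - dl u2 * d2| <= pi / (2 * e ^+ 2) * d2 ^+ 2.
  by have := heaviside_bregman e0 (u2 - 2^-1) (v2 - 2^-1); rewrite opprB addrA subrK.
have L1 : `|H v1 - H u1| <= e^-1 * `|d1|.
  by have := heaviside_lip e0 (u1 - 2^-1) (v1 - 2^-1); rewrite opprB addrA subrK.
have L2 : `|H v2 - H u2| <= e^-1 * `|d2|.
  by have := heaviside_lip e0 (u2 - 2^-1) (v2 - 2^-1); rewrite opprB addrA subrK.
pose A := fidelity px C.
have -> : F lam e v1 v2 px C - F lam e u1 u2 px C
    - f1 lam e u1 u2 px C * d1 - f2 lam e u1 u2 px C * d2
  = lam * \sum_r (((A 0 0 r - A 1 0 r) * H u2 + (A 0 1 r - A 1 1 r) * (1 - H u2))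
      * (H v1 - H u1 - dl u1 * d1)
    + ((A 0 0 r - A 0 1 r) * H u1 + (A 1 0 r - A 1 1 r) * (1 - H u1))
      * (H v2 - H u2 - dl u2 * d2)
    + (A 0 0 r - A 0 1 r - (A 1 0 r - A 1 1 r)) * ((H v1 - H u1) * (H v2 - H u2))).
  rewrite /F /f1 /f2 -!mulrBr -![lam * _ * _]mulrA -!mulrBr -!sumrB !mulr_suml -!sumrB.
  by congr (_ * _); apply: eq_bigr => r _; rewrite /A /H /dl; ring.
pose B := (d1 ^+ 2 + d2 ^+ 2) * (pi / e ^+ 2).
apply: (@le_trans _ _ (lam * (om%:R * B))); last first.
  rewrite /B [lam * _]mulrCA mulrA.
  rewrite [X in X <= _](_ : _ = (om%:R * lam * pi / e ^+ 2) * (d1 ^+ 2 + d2 ^+ 2)).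
    by rewrite ler_wpM2r // addr_ge0 ?sqr_ge0.
  by move: pi => q; ring.
rewrite ler_pM2l //; apply: sum_le => r.
have P1 : `|(A 0 0 r - A 1 0 r) * H u2 + (A 0 1 r - A 1 1 r) * (1 - H u2)| <= 1.
  by apply: weighted_le; rewrite ?diff_fid ?heaviside01.
have P2 : `|(A 0 0 r - A 0 1 r) * H u1 + (A 1 0 r - A 1 1 r) * (1 - H u1)| <= 1.
  by apply: weighted_le; rewrite ?diff_fid ?heaviside01.
have P3 : `|A 0 0 r - A 0 1 r - (A 1 0 r - A 1 1 r)| <= 2.
  have := diff_fid 0 0 0 1 r; have := diff_fid 1 0 1 1 r; rewrite ler_norml -/A.
  by move=> /andP[? ?] /andP[? ?]; lra.
have mulle (a b c : R) : `|a| <= 1 -> `|b| <= c -> a * b <= c.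
  move=> ha hb; apply: le_trans (ler_norm _) _; rewrite normrM.
  by apply: le_trans (ler_piMl _ ha) hb.
have T1 := mulle _ _ _ P1 B1; have T2 := mulle _ _ _ P2 B2.
have T3 : (A 0 0 r - A 0 1 r - (A 1 0 r - A 1 1 r)) * ((H v1 - H u1) * (H v2 - H u2))
    <= (e ^+ 2)^-1 * (d1 ^+ 2 + d2 ^+ 2).
  apply: le_trans (ler_norm _) _; rewrite normrM [X in _ * X]normrM.
  apply: (@le_trans _ _ (2 * ((e^-1 * `|d1|) * (e^-1 * `|d2|)))).
    by rewrite ler_pM // ?mulr_ge0 // ler_pM.
  have -> : 2 * (e^-1 * `|d1| * (e^-1 * `|d2|)) = (e ^+ 2)^-1 * (2 * (`|d1| * `|d2|)).
    by field; rewrite gt_eqF.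
  rewrite ler_wpM2l ?invr_ge0 ?sqr_ge0 //.
  rewrite -(real_normK (num_real d1)) -(real_normK (num_real d2)).
  by have := sqr_ge0 (`|d1| - `|d2|); lra.
apply: le_trans (lerD (lerD T1 T2) T3) _.
have i0 : 0 <= (e ^+ 2)^-1 * (d1 ^+ 2 + d2 ^+ 2).
  by rewrite mulr_ge0 ?invr_ge0 ?sqr_ge0 // addr_ge0 ?sqr_ge0.
have -> : pi / (2 * e ^+ 2) * d1 ^+ 2 + pi / (2 * e ^+ 2) * d2 ^+ 2
   + (e ^+ 2)^-1 * (d1 ^+ 2 + d2 ^+ 2) = (pi / 2 + 1) * ((e ^+ 2)^-1 * (d1 ^+ 2 + d2 ^+ 2)).
  by move: pi => q; field; rewrite gt_eqF.
have -> : B = pi * ((e ^+ 2)^-1 * (d1 ^+ 2 + d2 ^+ 2)) by rewrite /B; move: pi => q; ring.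
by rewrite ler_wpM2r //; lra.
Qed.

End Fidelity.

(** * Residuals of the schemes *)

Section Stage.
Variable R : realType.

Lemma dotC n (a b : 'cV[R]_n) : dot a b = dot b a.
Proof. by apply: eq_bigr => l _; rewrite mulrC. Qed.

Lemma dotDr n (a b c : 'cV[R]_n) : dot a (b + c) = dot a b + dot a c.
Proof. by rewrite /dot -big_split; apply: eq_bigr => l _; rewrite mxE mulrDr. Qed.

Lemma dotNr n (a b : 'cV[R]_n) : dot a (- b) = - dot a b.
Proof. by rewrite /dot -sumrN; apply: eq_bigr => l _; rewrite mxE mulrN. Qed.

Lemma dot_sym n (D : 'M[R]_n) (a b : 'cV[R]_n) : D^T = D -> dot a (D *m b) = dot b (D *m a).
Proof.
move=> Dt; have e (x y : 'cV[R]_n) : dot x (D *m y) = (x^T *m D *m y) 0 0.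
  by rewrite -mulmxA mxE; apply: eq_bigr => l _; rewrite [x^T _ _]mxE.
have tr (X : 'M[R]_1) : X 0 0 = X^T 0 0 by rewrite mxE.
by rewrite !e [LHS]tr !trmx_mul trmxK Dt mulmxA.
Qed.

Variables (n : nat) (D : 'M[R]_n) (S : R).
Hypothesis gD : generator D.

(** The residual equation is tested with [v - u + p]. The increment of the quadratic form is then
    exact by polarization, and only the nonnegative [dot p (D *m v)] is dropped. *)
Lemma phase_stage (u v nu p : 'cV[R]_n) : 0 <= dot p (D *m v) ->
  dot v (D *m v) / 2 - dot u (D *m u) / 2 <=
    - dot (nu - (D + S%:M) *m v) (v - u + p) - dot (v - u) (D *m (v - u)) / 2
    - \sum_l (S * (v l 0 - u l 0) + (S * u l 0 - nu l 0)) * (v l 0 - u l 0 + p l 0).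
Proof.
move=> pv; have Dt : D^T = D by case: gD.
set rho := nu - _; set d := v - u.
have eDv : D *m v = nu - rho - S *: v.
  by rewrite /rho mulmxDl mul_scalar_mx; apply/colP => l; rewrite !mxE; ring.
have e1 : dot v (D *m v) / 2 - dot u (D *m u) / 2 = dot d (D *m v) - dot d (D *m d) / 2.
  rewrite /d mulmxBr !dotDr !dotNr ![dot (v - u) _]dotC !dotDr !dotNr.
  rewrite ![dot (D *m _) _]dotC (dot_sym u v Dt); lra.
rewrite e1.
suff -> : \sum_l (S * (v l 0 - u l 0) + (S * u l 0 - nu l 0)) * (v l 0 - u l 0 + p l 0)
   = - dot rho (d + p) - dot d (D *m v) - dot p (D *m v) by lra.
rewrite dotDr eDv !dotDr !dotNr /dot -!sumrN -!big_split /=.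
rewrite -!sumrN -!big_split /=.
by apply: eq_bigr => l _; rewrite /d !mxE; ring.
Qed.

Section Coordinates.
Variables (m : nat) (P : 'M[R]_(m, n)) (ell : 'I_m -> R) (dt : R).
Hypothesis fP : frame (D + S%:M) S P ell.
Hypotheses (S_gt0 : 0 < S) (dt_gt0 : 0 < dt).
Local Notation hat a j := ((P *m a) j 0).
Local Notation L := (D + S%:M).
Local Notation mxf phi := (mxfun phi (dt *: L)).
Local Notation M j := (damp1 dt (ell j)).
Let ell0 j : 0 < ell j := ell_gt0 fP S_gt0 j.

Lemma hatB (a b : 'cV[R]_n) j : hat (a - b) j = hat a j - hat b j.
Proof. by rewrite mulmxBr !mxE. Qed.

Lemma etd1_residual (u v nu : 'cV[R]_n) j :
  v = mxf (@phi0 R) *m u + dt *: (mxf (@phi1 R) *m nu) ->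
  hat (nu - L *m v) j = M j * hat (v - u) j.
Proof.
move=> ev; rewrite !hatB (hat_L fP); apply: (etd1_coord dt_gt0) => //.
by rewrite [in LHS]ev mulmxDr -scalemxAr [LHS]mxE [X in _ + X]mxE !(hat_mxfun fP).
Qed.

Lemma etdrk2_residual (u v w nu nv : 'cV[R]_n) j :
  v = mxf (@phi0 R) *m u + dt *: (mxf (@phi1 R) *m nu) ->
  w = v + dt *: (mxf (@phi2 R) *m (nv - nu)) ->
  hat (nv - L *m w) j
   = (dt^-1 + damp2 dt (ell j)) * hat (w - v) j + M j * hat (v - u) j.
Proof.
move=> ev ew; have := etd1_residual j ev; rewrite !hatB !(hat_L fP) => h.
apply: (etdrk2_coord dt_gt0 (ell0 j) h).
by rewrite [in LHS]ew mulmxDr -scalemxAr [LHS]mxE [X in _ + X]mxE (hat_mxfun fP) hatB.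
Qed.

Let M_ge0 j : 0 <= M j. Proof. by apply: ltW; apply: damp1_gt0. Qed.

Let M_le j : M j <= damp1 dt S.
Proof. by apply: damp1_nincr => //; case: fP. Qed.

(** In each coordinate this is [damping1_chi]. As [damp1] decreases and the eigenvalues are at least
    [S], the weight of the test function is at most [damp1 dt S], and the sum returns to pixels. *)
Lemma residual_chi (d p rho : 'cV[R]_n) :
  (forall j, hat rho j = M j * hat d j) ->
  - dot rho (d + p) <= - (\sum_j M j / 16 * hat d j ^+ 2)
    + 3 / 8 * damp1 dt S * \sum_l p l 0 ^+ 2.
Proof.
move=> hr; have -> : \sum_l p l 0 ^+ 2 = dot p p by apply: eq_bigr => l _; rewrite expr2.
rewrite !(dot_hat fP) mulr_sumr -!sumrN -big_split /=; apply: ler_sum => j _.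
have -> : hat (d + p) j = hat d j + hat p j by rewrite mulmxDr mxE.
rewrite hr /=; apply: le_trans (damping1_chi _ _ (M_ge0 j)) _; rewrite lerD2l.
by have := ler_wpM2r (sqr_ge0 (hat p j)) (M_le j); lra.
Qed.

Lemma residual2_chi (d e p q rho rho2 : 'cV[R]_n) :
  (forall j, hat rho j = M j * hat d j) ->
  (forall j, hat rho2 j = (dt^-1 + damp2 dt (ell j)) * hat e j + M j * hat d j) ->
  - dot rho (d + p) - dot rho2 (e + q) <= - (\sum_j M j / 16 * hat d j ^+ 2)
    + 3 / 8 * damp1 dt S * \sum_l p l 0 ^+ 2
    + dt^-1 * \sum_l (- e l 0 ^+ 2 / 2 - e l 0 * q l 0 + 5 / 4 * q l 0 ^+ 2).
Proof.
move=> hr hr2.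
have -> : \sum_l p l 0 ^+ 2 = dot p p by apply: eq_bigr => l _; rewrite expr2.
have -> : \sum_l (- e l 0 ^+ 2 / 2 - e l 0 * q l 0 + 5 / 4 * q l 0 ^+ 2)
   = - (dot e e / 2) - dot e q + 5 / 4 * dot q q.
  rewrite /dot mulr_suml mulr_sumr -!sumrN -!big_split /=.
  by apply: eq_bigr => l _; ring.
rewrite !(dot_hat fP) !mulr_suml !mulr_sumr -!sumrN -!big_split /= mulr_sumr -big_split /=.
apply: ler_sum => j _.
have -> : hat (d + p) j = hat d j + hat p j by rewrite mulmxDr mxE.
have -> : hat (e + q) j = hat e j + hat q j by rewrite mulmxDr mxE.
rewrite hr hr2.
have h := damping2_chi (hat d j) (hat e j) (hat p j) (hat q j) (M_ge0 j)
  (damp1_le_damp2 dt_gt0 (ell0 j)) (damp2_le dt_gt0 (ell0 j)).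
have h2 : M j * hat p j ^+ 2 <= damp1 dt S * hat p j ^+ 2 by rewrite ler_wpM2r ?sqr_ge0.
lra.
Qed.

Let m_le j : damp1 dt S <= M j + (ell j - S) / 2.
Proof.
have [_ _ Sl] := fP.
by have := damp1_half dt_gt0 S_gt0 (Sl j); lra.
Qed.

Lemma residual_energy (d rho : 'cV[R]_n) :
  (forall j, hat rho j = M j * hat d j) ->
  - dot rho d - dot d (D *m d) / 2 <= - (3 / 4 * damp1 dt S * dot d d).
Proof.
move=> hr; rewrite !(dot_hat fP) mulr_suml mulr_sumr -!sumrN -big_split /=.
apply: ler_sum => j _; rewrite hr (hat_D fP).
have := damping1_energy (hat d j) (ltW (damp1_gt0 dt_gt0 S_gt0)) (m_le j).
lra.
Qed.

Lemma residual2_energy (d e rho rho2 : 'cV[R]_n) :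
  (forall j, hat rho j = M j * hat d j) ->
  (forall j, hat rho2 j = (dt^-1 + damp2 dt (ell j)) * hat e j + M j * hat d j) ->
  - dot rho d - dot d (D *m d) / 2 - dot rho2 e - dot e (D *m e) / 2
   <= - (3 / 4 * damp1 dt S * (dot d d + dot e e)).
Proof.
move=> hr hr2.
rewrite !(dot_hat fP) !mulr_suml -big_split mulr_sumr -!sumrN -!big_split /=.
apply: ler_sum => j _; rewrite hr hr2 !(hat_D fP).
have [_ _ Sl] := fP.
have D0 : 0 <= ell j - S by rewrite subr_ge0.
have := damping2_energy (hat d j) (hat e j) (ltW (damp1_gt0 dt_gt0 S_gt0)) (M_ge0 j)
  (damp1_le_damp2 dt_gt0 (ell0 j)) D0 (m_le j) (damp1_le dt_gt0 S_gt0).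
lra.
Qed.

Lemma damped_eq0 (d : 'cV[R]_n) : \sum_j M j / 16 * hat d j ^+ 2 = 0 -> d = 0.
Proof.
move=> /psumr_eq0P h; apply: (hat_eq0 fP) => j.
have hh i : true -> 0 <= M i / 16 * hat d i ^+ 2.
  by move=> _; rewrite mulr_ge0 ?sqr_ge0 // divr_ge0 // M_ge0.
have M16 : M j / 16 != 0 by rewrite gt_eqF // divr_gt0 // damp1_gt0.
by have /eqP := h hh j isT; rewrite mulrI_eq0 ?sqrf_eq0; [move/eqP|apply/lregP].
Qed.

Lemma damped_ge0 (d : 'cV[R]_n) : 0 <= \sum_j M j / 16 * hat d j ^+ 2.
Proof. by apply: sumr_ge0 => j _; rewrite mulr_ge0 ?sqr_ge0 // divr_ge0 // M_ge0. Qed.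

End Coordinates.
End Stage.

Lemma dwell_bregman (R : realType) (u v : R) :
  dwell v - dwell u - dwell' u * (v - u) = breg (u - 2^-1) (v - 2^-1) * (v - u) ^+ 2.
Proof. by rewrite /dwell /dwell' /breg; field. Qed.

Lemma overshoot_homo (R : realFieldType) : {homo @overshoot R : x y / x <= y}.
Proof. by move=> x y xy; rewrite /overshoot le_max2 // lerB. Qed.

Lemma chi_homo (R : realFieldType) : {homo @chi R : x y / x <= y}.
Proof.
move=> x y xy; rewrite /chi ler_pM2l // lerB //.
  by rewrite ler_sqr ?nnegrE ?overshoot_ge0 // overshoot_homo.
by rewrite ler_sqr ?nnegrE ?overshoot_ge0 // overshoot_homo // lerN2.
Qed.

(** * Decrease of the energy along the schemes *)

Section Model.
Variables (R : realType) (M1 M2 om : nat) (eps lam e h S dt : R).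
Variable img : 'I_(M2 * M1) -> 'I_om -> R.
Variable C : intensities R om.
Hypotheses (eps_gt0 : 0 < eps) (lam_gt0 : 0 < lam) (S_gt0 : 0 < S) (dt_gt0 : 0 < dt).
Hypotheses (e_gt0 : 0 < e) (e_le : e <= 6^-1).
Local Notation sg := (S - eps^-1).
Hypothesis sg_ge : om%:R * lam * pi / e ^+ 2 <= sg.
Hypothesis img01 : forall l r, 0 <= img l r <= 1.
Hypothesis C01 : forall a b r, 0 <= C a b r <= 1.

Local Notation phases := (phases R M1 M2).
Local Notation D := (- (2 * eps) *: Dh M1 M2 h).
Local Notation E U := (energy eps lam e h img U C).
Local Notation N U := (nonlin eps lam e S img U C).
Local Notation etd1 U := (etd1_step eps lam e h S dt img C U).
Local Notation rk2 U := (etdrk2_step eps lam e h S dt img C U).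
Local Notation step s U := (scheme_step eps lam e h S dt img s C U).
Implicit Types U V W : phases.

Let sg_ge0 : 0 <= sg.
Proof.
have p0 := pi_gt0 R; apply: le_trans sg_ge.
by rewrite divr_ge0 ?sqr_ge0 // !mulr_ge0 ?(ltW lam_gt0) ?(ltW p0).
Qed.

Let q_gt0 : 0 < eps^-1. Proof. by rewrite invr_gt0. Qed.

Let gD : generator D. Proof. by apply: Dh_generator; apply: ltW. Qed.

Let pix U l := eps^-1 * dwell (U.1 l 0) + eps^-1 * dwell (U.2 l 0)
  + F lam e (U.1 l 0) (U.2 l 0) (img l) C.

Let energyE U : E U = \sum_l pix U l + (dot U.1 (D *m U.1) / 2 + dot U.2 (D *m U.2) / 2).
Proof.
have q (u : 'cV[R]_(M2 * M1)) : dot u (D *m u) / 2 = - (eps * (u^T *m Dh M1 M2 h *m u) 0 0).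
  have -> : dot u (D *m u) = (u^T *m (D *m u)) 0 0.
    by rewrite mxE; apply: eq_bigr => l _; rewrite [u^T _ _]mxE.
  by rewrite -scalemxAl -scalemxAr mulmxA mxE; field.
by rewrite !q /energy /pix; lra.
Qed.

Let g1 U l := S * U.1 l 0 - (N U).1 l 0.
Let g2 U l := S * U.2 l 0 - (N U).2 l 0.

Let g1E U l : g1 U l = eps^-1 * dwell' (U.1 l 0) + f1 lam e (U.1 l 0) (U.2 l 0) (img l) C.
Proof. by rewrite /g1 /= mxE; ring. Qed.

Let g2E U l : g2 U l = eps^-1 * dwell' (U.2 l 0) + f2 lam e (U.1 l 0) (U.2 l 0) (img l) C.
Proof. by rewrite /g2 /= mxE; ring. Qed.

Let br (u v : 'cV[R]_(M2 * M1)) l :=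
  eps^-1 * ((breg (u l 0 - 2^-1) (v l 0 - 2^-1) - 1) * (v l 0 - u l 0) ^+ 2).

(** The remainders of fidelity and double well carry [S - eps^-1] and [eps^-1 * breg]; regrouping
    gives [S] plus [eps^-1 * (breg - 1)]. *)
Let pix_diff U V l : pix V l - pix U l <=
  g1 U l * (V.1 l 0 - U.1 l 0) + S * (V.1 l 0 - U.1 l 0) ^+ 2 + br U.1 V.1 l
  + (g2 U l * (V.2 l 0 - U.2 l 0) + S * (V.2 l 0 - U.2 l 0) ^+ 2 + br U.2 V.2 l).
Proof.
have := F_bregman lam_gt0 e_gt0 sg_ge (img01 l) C01 (U.1 l 0) (U.2 l 0) (V.1 l 0) (V.2 l 0).
have brE (u v : 'cV[R]_(M2 * M1)) : br u v l = eps^-1 * (dwell (v l 0) - dwell (u l 0)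
    - dwell' (u l 0) * (v l 0 - u l 0)) - eps^-1 * (v l 0 - u l 0) ^+ 2.
  by rewrite dwell_bregman /br; ring.
rewrite g1E g2E !brE /pix; lra.
Qed.

Let stage U V (p : phases) : 0 <= dot p.1 (D *m V.1) -> 0 <= dot p.2 (D *m V.2) ->
  E V - E U <=
   (- dot ((N U).1 - (D + S%:M) *m V.1) (V.1 - U.1 + p.1)
    - dot (V.1 - U.1) (D *m (V.1 - U.1)) / 2
    + \sum_l (br U.1 V.1 l - (S * (V.1 l 0 - U.1 l 0) + g1 U l) * p.1 l 0))
   + (- dot ((N U).2 - (D + S%:M) *m V.2) (V.2 - U.2 + p.2)
    - dot (V.2 - U.2) (D *m (V.2 - U.2)) / 2
    + \sum_l (br U.2 V.2 l - (S * (V.2 l 0 - U.2 l 0) + g2 U l) * p.2 l 0)).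
Proof.
move=> p1 p2; rewrite !energyE.
have s1 := @phase_stage R _ D S gD U.1 V.1 (N U).1 p.1 p1.
have s2 := @phase_stage R _ D S gD U.2 V.2 (N U).2 p.2 p2.
have s3 : \sum_l pix V l - \sum_l pix U l <= \sum_l (
  (S * (V.1 l 0 - U.1 l 0) + g1 U l) * (V.1 l 0 - U.1 l 0 + p.1 l 0))
  + \sum_l (br U.1 V.1 l - (S * (V.1 l 0 - U.1 l 0) + g1 U l) * p.1 l 0)
  + (\sum_l ((S * (V.2 l 0 - U.2 l 0) + g2 U l) * (V.2 l 0 - U.2 l 0 + p.2 l 0))
  + \sum_l (br U.2 V.2 l - (S * (V.2 l 0 - U.2 l 0) + g2 U l) * p.2 l 0)).
  rewrite -sumrB -!big_split /=; apply: ler_sum => l _.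
  by apply: le_trans (pix_diff U V l) _; lra.
rewrite /g1 /g2 in s3 *; lra.
Qed.

Definition inbox (b : R) U :=
  forall l, `|U.1 l 0 - 2^-1| <= b /\ `|U.2 l 0 - 2^-1| <= b.

(** The bounded expression is the nonlinearity without fidelity force, centred at 1/2. *)
Definition invariant_radius (b : R) :=
  2^-1 <= b /\ forall x, `|x| <= b -> `|sg * x + eps^-1 * (2 * x - 4 * x ^+ 3)| <= S * b.

(** The fidelity force acts only within 1/6 of the centre, where the other terms leave enough room
    below [S / 2]. *)
Let phase_nonlin b (u f : R) : invariant_radius b -> `|u - 2^-1| <= b -> `|f| <= sg / 12 ->
  (6^-1 <= `|u - 2^-1| -> f = 0) ->
  `|S * u - eps^-1 * dwell' u - f - S / 2| <= S * b.
Proof.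
move=> [b2 hb] ub fle f0; set x := u - 2^-1 in ub f0.
have -> : S * u - eps^-1 * dwell' u - f - S / 2
   = sg * x + eps^-1 * (2 * x - 4 * x ^+ 3) - f by rewrite /dwell' /x; field; rewrite gt_eqF.
have [x6|/ltW x6] := leP 6^-1 `|x|; first by rewrite (f0 x6) subr0; apply: hb.
have sb : S / 2 <= S * b by rewrite ler_pM2l.
have hx : `|sg * x| <= sg / 6 by rewrite normrM (ger0_norm sg_ge0) ler_wpM2l.
have hw : `|eps^-1 * (2 * x - 4 * x ^+ 3)| <= eps^-1 / 3.
  rewrite normrM (gtr0_norm q_gt0) ler_pM2l //.
  have -> : 2 * x - 4 * x ^+ 3 = x * (2 - 4 * x ^+ 2) by ring.
  have -> : 3^-1 = 6^-1 * 2 :> R by field.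
  rewrite normrM; apply: ler_pM => //.
  have : x ^+ 2 <= 1 by move: x6; rewrite ler_norml => /andP[a1 a2]; nra.
  by have := sqr_ge0 x; rewrite ler_norml; lra.
move: hx hw fle; rewrite !ler_norml => /andP[a1 a2] /andP[a3 a4] /andP[a5 a6].
by have := sg_ge0; have := q_gt0; lra.
Qed.

Let nonlin_bound b U : invariant_radius b -> inbox b U ->
  forall l, `|(N U).1 l 0 - S / 2| <= S * b /\ `|(N U).2 l 0 - S / 2| <= S * b.
Proof.
move=> hb hU l; have [u1 u2] := hU l; split; rewrite /= mxE; apply: phase_nonlin => //.
- exact: f1_le.
- exact: f1_eq0.
- exact: f2_le.
- exact: f2_eq0.
Qed.

Local Notation mxf phi := (mxfun phi (dt *: (D + S%:M))).

Let etd_bound b (u n0 z : 'cV[R]_(M2 * M1)) :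
  (forall l, `|u l 0 - 2^-1| <= b) -> (forall l, `|n0 l 0 - S / 2| <= S * b) ->
  (forall l, `|n0 l 0 + z l 0 - S / 2| <= S * b) ->
  forall l, `|(mxf (@phi0 R) *m u + dt *: (mxf (@phi1 R) *m n0)
     + dt *: (mxf (@phi2 R) *m z)) l 0 - 2^-1| <= b.
Proof.
move=> hu hn hz l; have [m [P [ell fP]]] := generator_frame S gD.
have up := etd_upper_bound fP gD S_gt0 dt_gt0.
rewrite ler_norml; apply/andP; split; last first.
  rewrite lerBlDr; apply: up => k.
  - by have := hu k; rewrite ler_norml => /andP[_]; lra.
  - by have := hn k; rewrite ler_norml => /andP[_]; lra.
  - by have := hz k; rewrite ler_norml => /andP[_]; lra.
(* The lower bound is the upper bound for the negated data. *)
have := up (b - 2^-1) (- u) (- n0) (- z).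
rewrite !mulmxN !scalerN -!opprD => lo.
suff : (- (mxf (@phi0 R) *m u + dt *: (mxf (@phi1 R) *m n0)
     + dt *: (mxf (@phi2 R) *m z))) l 0 <= b - 2^-1 by rewrite mxE; lra.
apply: lo => k; rewrite !mxE.
- by have := hu k; rewrite ler_norml => /andP[+ _]; lra.
- by have := hn k; rewrite ler_norml => /andP[+ _]; lra.
- by have := hz k; rewrite ler_norml => /andP[+ _]; lra.
Qed.

Let etd1E1 U : (etd1 U).1 = mxf (@phi0 R) *m U.1 + dt *: (mxf (@phi1 R) *m (N U).1).
Proof. by []. Qed.
Let etd1E2 U : (etd1 U).2 = mxf (@phi0 R) *m U.2 + dt *: (mxf (@phi1 R) *m (N U).2).
Proof. by []. Qed.
Let rk2E1 U : (rk2 U).1 = (etd1 U).1 + dt *: (mxf (@phi2 R) *m ((N (etd1 U)).1 - (N U).1)).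
Proof. by []. Qed.
Let rk2E2 U : (rk2 U).2 = (etd1 U).2 + dt *: (mxf (@phi2 R) *m ((N (etd1 U)).2 - (N U).2)).
Proof. by []. Qed.

Let etd1_inbox b U : invariant_radius b -> inbox b U -> inbox b (etd1 U).
Proof.
move=> hb hU l; rewrite etd1E1 etd1E2.
have bd (u n0 : 'cV[R]_(M2 * M1)) : (forall k, `|u k 0 - 2^-1| <= b) ->
    (forall k, `|n0 k 0 - S / 2| <= S * b) ->
    `|(mxf (@phi0 R) *m u + dt *: (mxf (@phi1 R) *m n0)) l 0 - 2^-1| <= b.
  move=> hu hn; have := @etd_bound b u n0 0 hu hn; rewrite mulmx0 scaler0 addr0; apply.
  move=> k; rewrite (_ : (0 : 'cV[R]_(M2 * M1)) k 0 = 0) ?addr0 ?mxE //.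
by split; apply: bd => k; have [] := hU k; have [] := nonlin_bound hb hU k.
Qed.

(** The forcing interpolates between the nonlinearity at [U] and at the predictor, so the predictor
    has to be in the box first. *)
Let rk2_inbox b U : invariant_radius b -> inbox b U -> inbox b (rk2 U).
Proof.
move=> hb hU l; rewrite rk2E1 rk2E2 etd1E1 etd1E2.
have hN := nonlin_bound hb hU.
have hNV := nonlin_bound hb (etd1_inbox hb hU).
have cancel (x y : 'cV[R]_(M2 * M1)) k : x k 0 + (y - x) k 0 = y k 0 by rewrite !mxE; ring.
by split; apply: etd_bound => k; rewrite ?cancel; have [] := hU k;
  have [] := hN k; have [] := hNV k.
Qed.

Lemma step_inbox s b U : invariant_radius b -> inbox b U -> inbox b (step s U).
Proof. by case: s; [apply: etd1_inbox|apply: rk2_inbox]. Qed.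

Local Notation m0 := (damp1 dt S).

Let dot_eq0 (n : nat) (a : 'cV[R]_n) : dot a a = 0 -> a = 0.
Proof.
move=> /psumr_eq0P a0; apply/colP => l; rewrite [RHS]mxE.
have a2 i : true -> 0 <= a i 0 * a i 0 by rewrite -expr2 sqr_ge0.
by have /eqP := a0 a2 l isT; rewrite mulf_eq0 orbb => /eqP.
Qed.

Let dot_ge0 (n : nat) (a : 'cV[R]_n) : 0 <= dot a a.
Proof. by apply: sumr_ge0 => l _; rewrite -expr2 sqr_ge0. Qed.

Let dot0l (n : nat) (a : 'cV[R]_n) : dot 0 a = 0.
Proof. by rewrite /dot big1 // => l _; rewrite mxE mul0r. Qed.

(** With zero test function; in the box [breg] is at most [6 b ^ 2 - 1 / 2]. *)
Let stage0 b U V : inbox b U -> inbox b V ->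
  E V - E U <=
   (- dot ((N U).1 - (D + S%:M) *m V.1) (V.1 - U.1)
    - dot (V.1 - U.1) (D *m (V.1 - U.1)) / 2)
   + (- dot ((N U).2 - (D + S%:M) *m V.2) (V.2 - U.2)
    - dot (V.2 - U.2) (D *m (V.2 - U.2)) / 2)
   + eps^-1 * (6 * b ^+ 2 - 3 / 2) * (dot (V.1 - U.1) (V.1 - U.1) + dot (V.2 - U.2) (V.2 - U.2)).
Proof.
move=> hU hV.
have := @stage U V (0, 0); rewrite /= !dot0l !addr0 => /(_ (lexx 0) (lexx 0)) st.
apply: le_trans st _.
have brle (u v : 'cV[R]_(M2 * M1)) (g : 'I_(M2 * M1) -> R) :
   (forall l, `|u l 0 - 2^-1| <= b) -> (forall l, `|v l 0 - 2^-1| <= b) ->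
   \sum_l (br u v l - g l * (0 : 'cV[R]_(M2 * M1)) l 0)
    <= eps^-1 * (6 * b ^+ 2 - 3 / 2) * dot (v - u) (v - u).
  move=> hu hv; rewrite /dot mulr_sumr; apply: ler_sum => l _.
  rewrite !mxE mulr0 subr0 /br -mulrA ler_pM2l // -expr2 ler_wpM2r ?sqr_ge0 //.
  have := hu l; have := hv l; rewrite !ler_norml /breg.
  set x := u l 0 - 2^-1; set y := v l 0 - 2^-1 => /andP[y1 y2] /andP[x1 x2].
  have sx : x ^+ 2 <= b ^+ 2 by nra.
  have sy : y ^+ 2 <= b ^+ 2 by nra.
  by have := sqr_ge0 (x - y); lra.
have b1 := brle U.1 V.1 (fun l => S * (V.1 l 0 - U.1 l 0) + g1 U l)
  (fun l => (hU l).1) (fun l => (hV l).1).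
have b2 := brle U.2 V.2 (fun l => S * (V.2 l 0 - U.2 l 0) + g2 U l)
  (fun l => (hU l).2) (fun l => (hV l).2).
lra.
Qed.

Let fixed_of_dot U V : dot (V.1 - U.1) (V.1 - U.1) + dot (V.2 - U.2) (V.2 - U.2) = 0 -> V = U.
Proof.
move=> /eqP; rewrite paddr_eq0 // => /andP[/eqP/dot_eq0/eqP h1 /eqP/dot_eq0/eqP h2].
move: h1 h2; rewrite !subr_eq0 => /eqP h1 /eqP h2.
by rewrite [V]surjective_pairing h1 h2 -surjective_pairing.
Qed.

Let telescope0 (E0 E1 E2 K c x1 x1' x2 x2' y1 y1' y2 y2' a1 a2 b1 b2 : R) :
  E1 - E0 <= (- x1 - x1') + (- x2 - x2') + K * (a1 + a2) ->
  E2 - E1 <= (- y1 - y1') + (- y2 - y2') + K * (b1 + b2) ->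
  - x1 - x1' - y1 - y1' <= - (c * (a1 + b1)) ->
  - x2 - x2' - y2 - y2' <= - (c * (a2 + b2)) -> 0 <= (c - K) * (b1 + b2) ->
  E2 <= E0 - (c - K) * (a1 + a2).
Proof. lra. Qed.

(** The damping [3 / 4 m0] outweighs the nonconvex excess in both stages. The surplus controls the
    squared predictor increment, so equality makes [U] a fixed point of ETD1. *)
Lemma energy_decrease s b U : invariant_radius b ->
  eps^-1 * (6 * b ^+ 2 - 3 / 2) < 3 / 4 * m0 -> inbox b U ->
  E (step s U) <= E U /\ (E (step s U) = E U -> etd1 U = U).
Proof.
move=> hb hm hU; have hV := etd1_inbox hb hU.
have [m [P [ell fP]]] := generator_frame S gD.
have r1 j := etd1_residual fP S_gt0 dt_gt0 j (etd1E1 U).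
have r2 j := etd1_residual fP S_gt0 dt_gt0 j (etd1E2 U).
have st := stage0 hU hV.
set c := 3 / 4 * m0 - eps^-1 * (6 * b ^+ 2 - 3 / 2).
have c0 : 0 < c by rewrite /c subr_gt0.
set dd := dot ((etd1 U).1 - U.1) ((etd1 U).1 - U.1) + dot ((etd1 U).2 - U.2) ((etd1 U).2 - U.2).
have dd0 : 0 <= dd by rewrite /dd addr_ge0.
suff h' : E (step s U) <= E U - c * dd.
  split; first by apply: le_trans h' _; rewrite gerBl mulr_ge0 // ltW.
  move=> e'; apply: fixed_of_dot; rewrite -/dd; apply/eqP; rewrite eq_le dd0 andbT.
  by rewrite -(pmulr_rle0 _ c0); lra.
case: s => /=.
  have h1 := residual_energy fP S_gt0 dt_gt0 r1.
  have h2 := residual_energy fP S_gt0 dt_gt0 r2.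
  rewrite -/(etd1 U); rewrite /c /dd; lra.
have hW := rk2_inbox hb hU; have st2 := stage0 hV hW.
have q1 j := etdrk2_residual fP S_gt0 dt_gt0 j (etd1E1 U) (rk2E1 U).
have q2 j := etdrk2_residual fP S_gt0 dt_gt0 j (etd1E2 U) (rk2E2 U).
have h1 := residual2_energy fP S_gt0 dt_gt0 r1 q1.
have h2 := residual2_energy fP S_gt0 dt_gt0 r2 q2.
set ee := dot ((rk2 U).1 - (etd1 U).1) ((rk2 U).1 - (etd1 U).1)
  + dot ((rk2 U).2 - (etd1 U).2) ((rk2 U).2 - (etd1 U).2).
have ee0 : 0 <= c * ee by rewrite mulr_ge0 ?(ltW c0) // /ee addr_ge0.
exact: (telescope0 st st2 h1 h2 ee0).
Qed.

Definition lyapunov (k : R) U : R :=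
  E U + k * \sum_l (psi (U.1 l 0 - 2^-1) + psi (U.2 l 0 - 2^-1)).

Let chiv (v : 'cV[R]_(M2 * M1)) : 'cV[R]_(M2 * M1) := \col_l chi (v l 0 - 2^-1).

Let chiv_D v : 0 <= dot (chiv v) (D *m v).
Proof.
apply: generator_form => // l k; rewrite !mxE.
have [vlk|/ltW vlk] := leP (v l 0) (v k 0).
  by rewrite mulr_le0 // subr_le0 // chi_homo // lerB.
by rewrite mulr_ge0 // subr_ge0 // chi_homo // lerB.
Qed.

(** * The regime where the energy needs the penalty *)

Hypotheses (S_le : S <= 2 * eps^-1) (m0_le : m0 <= 3 / 8 * eps^-1).

Let s_ge1 : 1 <= S * eps.
Proof. by rewrite -(mulVf (lt0r_neq0 eps_gt0)) ler_pM2r // -subr_ge0. Qed.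

Let s_le2 : S * eps <= 2.
Proof. by rewrite -ler_pdivlMr. Qed.

Let sg_le : sg <= eps^-1. Proof. by have := S_le; lra. Qed.

Let phi_le f : `|f| <= sg / 12 -> `|f * eps| <= 12^-1.
Proof.
move=> hf; rewrite normrM (gtr0_norm eps_gt0) -ler_pdivlMr //; apply: le_trans hf _.
by have := sg_le; lra.
Qed.

Let phi_eq0 (f x : R) : (6^-1 <= `|x| -> f = 0) -> f * eps = 0 \/ `|x| <= 6^-1.
Proof.
by move=> h0; have [/h0 ->|/ltW] := leP 6^-1 `|x|; [left; rewrite mul0r|right].
Qed.

Section Pixels.
Variables (u v : 'cV[R]_(M2 * M1)) (f : 'I_(M2 * M1) -> R).
Hypothesis u_box : forall l, `|u l 0 - 2^-1| <= 49 / 90.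
Hypothesis v_box : forall l, `|v l 0 - 2^-1| <= 49 / 90.
Hypothesis f_le : forall l, `|f l| <= sg / 12.
Hypothesis f_eq0 : forall l, 6^-1 <= `|u l 0 - 2^-1| -> f l = 0.

Let rescale (tau : R) l (x := u l 0 - 2^-1) (y := v l 0 - 2^-1) :
  eps^-1 * ((breg x y - 1) * (y - x) ^+ 2
    - ((S * eps) * (y - x) + (4 * x ^+ 3 - x) + f l * eps) * chi y) =
  br u v l - (S * (v l 0 - u l 0) + (eps^-1 * dwell' (u l 0) + f l)) * chiv v l 0.
Proof. by rewrite /br /chiv mxE /dwell' /x /y; field; rewrite gt_eqF. Qed.

Lemma phase_pixels1 :
  \sum_l (br u v l - (S * (v l 0 - u l 0) + (eps^-1 * dwell' (u l 0) + f l)) * chiv v l 0)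
  + 3 / 8 * m0 * \sum_l chiv v l 0 ^+ 2 + eps^-1 * \sum_l psi (v l 0 - 2^-1)
  <= eps^-1 * \sum_l psi (u l 0 - 2^-1).
Proof.
rewrite !mulr_sumr -!big_split /=; apply: ler_sum => l _.
have := pixel_stage1 (u_box l) (v_box l) s_ge1 s_le2 (phi_le (f_le l)) (phi_eq0 (@f_eq0 l)).
move/(ler_wpM2l (ltW q_gt0)) => hp; apply: (le_trans _ hp) => {hp}.
rewrite [leRHS]mulrDr [X in _ <= X + _]mulrDr rescale // lerD2r lerD2l mxE.
by have := ler_wpM2r (sqr_ge0 (chi (v l 0 - 2^-1))) m0_le; lra.
Qed.

Lemma phase_pixels2 :
  \sum_l (br u v l - (S * (v l 0 - u l 0) + (eps^-1 * dwell' (u l 0) + f l)) * chiv v l 0)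
  + dt^-1 * \sum_l (- (v - u) l 0 ^+ 2 / 2 - (v - u) l 0 * chiv v l 0
                     + 5 / 4 * chiv v l 0 ^+ 2)
  + eps^-1 * \sum_l psi (v l 0 - 2^-1)
  <= eps^-1 * \sum_l psi (u l 0 - 2^-1).
Proof.
rewrite !mulr_sumr -!big_split /=; apply: ler_sum => l _.
have tau0 : 0 <= dt^-1 * eps by rewrite mulr_ge0 ?invr_ge0 // ltW.
(* From [1 / dt <= m0 + S / 2] and [m0 <= 3 / 8 * eps^-1]. *)
have tau1 : dt^-1 * eps <= 3 / 8 + S * eps / 2.
  rewrite -ler_pdivlMr // mulrDl -mulrA [eps / 2]mulrC -!mulrA mulfV ?gt_eqF //.
  by have := damp1_ge dt_gt0 S_gt0; have := m0_le; lra.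
have := pixel_stage2 (u_box l) (v_box l) s_ge1 s_le2 (phi_le (f_le l)) (phi_eq0 (@f_eq0 l))
  tau0 tau1.
move/(ler_wpM2l (ltW q_gt0)) => hp; apply: (le_trans _ hp) => {hp}.
rewrite [leRHS]mulrDr [X in _ <= X + _]mulrDr rescale // lerD2r lerD2l !mxE.
by rewrite le_eqVlt; apply/orP; left; apply/eqP; field; rewrite !gt_eqF.
Qed.

End Pixels.

Let stage_chi U V :
  E V - E U <=
   (- dot ((N U).1 - (D + S%:M) *m V.1) (V.1 - U.1 + chiv V.1)
    + \sum_l (br U.1 V.1 l - (S * (V.1 l 0 - U.1 l 0) + (eps^-1 * dwell' (U.1 l 0)
        + f1 lam e (U.1 l 0) (U.2 l 0) (img l) C)) * chiv V.1 l 0))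
   + (- dot ((N U).2 - (D + S%:M) *m V.2) (V.2 - U.2 + chiv V.2)
    + \sum_l (br U.2 V.2 l - (S * (V.2 l 0 - U.2 l 0) + (eps^-1 * dwell' (U.2 l 0)
        + f2 lam e (U.1 l 0) (U.2 l 0) (img l) C)) * chiv V.2 l 0)).
Proof.
have := @stage U V (chiv V.1, chiv V.2) (chiv_D _) (chiv_D _).
have d1 := generator_psd (V.1 - U.1) gD; have d2 := generator_psd (V.2 - U.2) gD.
under eq_bigr do rewrite g1E.
under [X in _ <= _ + (_ + X) -> _]eq_bigr do rewrite g2E.
by rewrite /=; lra.
Qed.

Let lyapunovE U : lyapunov eps^-1 U = E U
  + (eps^-1 * (\sum_l psi (U.1 l 0 - 2^-1)) + eps^-1 * \sum_l psi (U.2 l 0 - 2^-1)).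
Proof. by rewrite /lyapunov big_split mulrDr. Qed.

Let telescope1 (E0 E1 A1 A2 B1 B2 L1 L2 C1 C2 Q1 Q2 T1 T2 : R) :
  E1 - E0 <= (- A1 + B1) + (- A2 + B2) -> - A1 <= - L1 + C1 -> - A2 <= - L2 + C2 ->
  B1 + C1 + T1 <= Q1 -> B2 + C2 + T2 <= Q2 ->
  E1 + (T1 + T2) <= E0 + (Q1 + Q2) - (L1 + L2).
Proof. lra. Qed.

Let telescope2 (E0 E1 E2 A1 A2 B1 B2 L1 L2 C1 C2 Q1 Q2 T1 T2
    A1' A2' B1' B2' C1' C2' T1' T2' : R) :
  E1 - E0 <= (- A1 + B1) + (- A2 + B2) -> E2 - E1 <= (- A1' + B1') + (- A2' + B2') ->
  - A1 - A1' <= - L1 + C1 + C1' -> - A2 - A2' <= - L2 + C2 + C2' ->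
  B1 + C1 + T1 <= Q1 -> B2 + C2 + T2 <= Q2 -> B1' + C1' + T1' <= T1 -> B2' + C2' + T2' <= T2 ->
  E2 + (T1' + T2') <= E0 + (Q1 + Q2) - (L1 + L2).
Proof. lra. Qed.

(** The pixel inequalities of the stages telescope: for ETDRK2 the penalty of the predictor is
    gained in the first stage and spent in the second. A positive definite loss in the predictor
    increment remains. *)
Lemma lyapunov_decrease s U : invariant_radius (49 / 90) -> inbox (49 / 90) U ->
  lyapunov eps^-1 (step s U) <= lyapunov eps^-1 U /\
  (lyapunov eps^-1 (step s U) = lyapunov eps^-1 U -> etd1 U = U).
Proof.
move=> hb hU; have hV := etd1_inbox hb hU.
have [m [P [ell fP]]] := generator_frame S gD.
have r1 j := etd1_residual fP S_gt0 dt_gt0 j (etd1E1 U).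
have r2 j := etd1_residual fP S_gt0 dt_gt0 j (etd1E2 U).
pose loss (d : 'cV[R]_(M2 * M1)) := \sum_j damp1 dt (ell j) / 16 * (P *m d) j 0 ^+ 2.
have loss0 d : 0 <= loss d := damped_ge0 fP S_gt0 dt_gt0 d.
suff h' : lyapunov eps^-1 (step s U) <= lyapunov eps^-1 U
    - (loss ((etd1 U).1 - U.1) + loss ((etd1 U).2 - U.2)).
  have l1 := loss0 ((etd1 U).1 - U.1); have l2 := loss0 ((etd1 U).2 - U.2).
  split; first by lra.
  move=> e'; rewrite [etd1 U]surjective_pairing [RHS]surjective_pairing; congr pair.
    have l0 : loss ((etd1 U).1 - U.1) = 0 by lra.
    by apply/eqP; rewrite -subr_eq0; apply/eqP; apply: (damped_eq0 fP S_gt0 dt_gt0 l0).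
  have l0 : loss ((etd1 U).2 - U.2) = 0 by lra.
  by apply/eqP; rewrite -subr_eq0; apply/eqP; apply: (damped_eq0 fP S_gt0 dt_gt0 l0).
have force1 (X : phases) l := f1_le lam_gt0 e_gt0 e_le sg_ge (img01 l) C01 (X.1 l 0) (X.2 l 0).
have force2 (X : phases) l := f2_le lam_gt0 e_gt0 e_le sg_ge (img01 l) C01 (X.1 l 0) (X.2 l 0).
have zero1 (X : phases) l := @f1_eq0 R om lam e e_gt0 e_le (img l) C (X.1 l 0) (X.2 l 0).
have zero2 (X : phases) l := @f2_eq0 R om lam e e_gt0 e_le (img l) C (X.1 l 0) (X.2 l 0).
have st := stage_chi U (etd1 U).
have p1 := phase_pixels1 (fun l => (hU l).1) (fun l => (hV l).1) (force1 U) (zero1 U).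
have p2 := phase_pixels1 (fun l => (hU l).2) (fun l => (hV l).2) (force2 U) (zero2 U).
rewrite !lyapunovE; case: s => /=.
  have h1 := residual_chi fP S_gt0 dt_gt0 (chiv (etd1 U).1) r1.
  have h2 := residual_chi fP S_gt0 dt_gt0 (chiv (etd1 U).2) r2.
  exact: (telescope1 st h1 h2 p1 p2).
have hW := rk2_inbox hb hU; have st2 := stage_chi (etd1 U) (rk2 U).
have c1 j := etdrk2_residual fP S_gt0 dt_gt0 j (etd1E1 U) (rk2E1 U).
have c2 j := etdrk2_residual fP S_gt0 dt_gt0 j (etd1E2 U) (rk2E2 U).
have q1 := phase_pixels2 (fun l => (hV l).1) (fun l => (hW l).1) (force1 (etd1 U)) (zero1 (etd1 U)).
have q2 := phase_pixels2 (fun l => (hV l).2) (fun l => (hW l).2) (force2 (etd1 U)) (zero2 (etd1 U)).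
have h1 := residual2_chi fP S_gt0 dt_gt0 (chiv (etd1 U).1) (chiv (rk2 U).1) r1 c1.
have h2 := residual2_chi fP S_gt0 dt_gt0 (chiv (etd1 U).2) (chiv (rk2 U).2) r2 c2.
exact: (telescope2 st st2 h1 h2 p1 p2 q1 q2).
Qed.

End Model.

(** * Steady states *)

Section Limits.
Variable R : realType.

Lemma lipschitz_cvg (f : R -> R) (c : R) (a : nat -> R) (l : R) :
  0 <= c -> (forall x y, `|f y - f x| <= c * `|y - x|) ->
  a @ \oo --> l -> (fun n => f (a n)) @ \oo --> f l.
Proof.
move=> c0 hf al; apply/cvgrPdist_le => d d0.
(* Dividing by [c + 1] avoids the case [c = 0]. *)
have c1 : 0 < c + 1 by lra.
have /cvgrPdist_le/(_ _ (divr_gt0 d0 c1)) := al.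
apply: filterS => n h; apply: le_trans (hf _ _) _.
apply: le_trans (ler_wpM2l c0 h) _.
rewrite mulrCA ler_piMr ?(ltW d0) // ler_pdivrMr // mul1r; lra.
Qed.

Lemma cvg_sumr (I : finType) (f : I -> nat -> R) (l : I -> R) :
  (forall i, f i @ \oo --> l i) -> (fun n => \sum_i f i n) @ \oo --> \sum_i l i.
Proof. by move=> h; apply: cvg_big => //; exact: add_continuous. Qed.

Lemma cvg_exprn (a : nat -> R) (l : R) k :
  a @ \oo --> l -> (fun n => a n ^+ k) @ \oo --> l ^+ k.
Proof. move=> al; exact: (cvg_comp _ (fun x => x ^+ k) al (@exprn_continuous R k l)). Qed.

Lemma cvg_overshoot (a : nat -> R) (l : R) :
  a @ \oo --> l -> (fun n => overshoot (a n)) @ \oo --> overshoot l.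
Proof.
apply: (@lipschitz_cvg (@overshoot R) 1) => // x y; rewrite mul1r /overshoot.
have := ler_norm (y - x); have := ler_norm (x - y); rewrite [`|x - y|]distrC ler_norml.
by case: (leP 0 (y - 2^-1)); case: (leP 0 (x - 2^-1)); lra.
Qed.

Lemma cvg_psi (a : nat -> R) (l : R) :
  a @ \oo --> l -> (fun n => psi (a n)) @ \oo --> psi l.
Proof.
move=> h; have h1 := cvg_overshoot h.
have h2 : (fun n => overshoot (- a n)) @ \oo --> overshoot (- l).
  by apply: cvg_overshoot; exact: cvgN.
have e1 k := @cvg_exprn _ _ k h1; have e2 k := @cvg_exprn _ _ k h2.
exact: (cvgD (cvgM (cvg_cst _) (cvgD (e1 3) (e2 3))) (cvgM (cvg_cst _) (cvgD (e1 4) (e2 4)))).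
Qed.

Lemma cvg_dwell (a : nat -> R) (l : R) :
  a @ \oo --> l -> (fun n => dwell (a n)) @ \oo --> dwell l.
Proof.
move=> h; have h1 : (fun n => a n - 1) @ \oo --> l - 1 by apply: cvgB => //; exact: cvg_cst.
exact: (cvgM (@cvg_exprn _ _ 2 h) (@cvg_exprn _ _ 2 h1)).
Qed.

Lemma cvg_heaviside (e : R) (a : nat -> R) (l : R) : 0 < e ->
  a @ \oo --> l -> (fun n => heaviside e (a n - 2^-1)) @ \oo --> heaviside e (l - 2^-1).
Proof.
move=> e0 h; have h' : (fun n => a n - 2^-1) @ \oo --> l - 2^-1.
  by apply: cvgB => //; exact: cvg_cst.
apply: (lipschitz_cvg _ _ h'); last exact: (heaviside_lip e0).
by rewrite invr_ge0 ltW.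
Qed.

Variables (M1 M2 om : nat) (eps lam e h : R).
Variable img : 'I_(M2 * M1) -> 'I_om -> R.
Variable C : intensities R om.
Hypothesis e_gt0 : 0 < e.
Variables (u : nat -> phases R M1 M2) (V : phases R M1 M2).
Hypothesis uV : u @ \oo --> V.

Lemma cvg_fst_coord l : (fun n => (u n).1 l 0) @ \oo --> V.1 l 0.
Proof.
have h1 : (fun n => (u n).1) @ \oo --> V.1 by apply: (cvg_comp _ _ uV); exact: cvg_fst.
exact: (cvg_comp _ (fun M : 'cV[R]_(M2 * M1) => M l 0) h1 (@coord_continuous R _ _ l 0 V.1)).
Qed.

Lemma cvg_snd_coord l : (fun n => (u n).2 l 0) @ \oo --> V.2 l 0.
Proof.
have h1 : (fun n => (u n).2) @ \oo --> V.2 by apply: (cvg_comp _ _ uV); exact: cvg_snd.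
exact: (cvg_comp _ (fun M : 'cV[R]_(M2 * M1) => M l 0) h1 (@coord_continuous R _ _ l 0 V.2)).
Qed.

Lemma cvg_form (D : 'M[R]_(M2 * M1)) (a : nat -> 'cV[R]_(M2 * M1)) (b : 'cV[R]_(M2 * M1)) :
  (forall l, (fun n => a n l 0) @ \oo --> b l 0) ->
  (fun n => ((a n)^T *m D *m a n) 0 0) @ \oo --> (b^T *m D *m b) 0 0.
Proof.
move=> ab; have q (x : 'cV[R]_(M2 * M1)) :
    (x^T *m D *m x) 0 0 = \sum_j (\sum_i x i 0 * D i j) * x j 0.
  by rewrite mxE; apply: eq_bigr => j _; rewrite mxE; congr (_ * _);
    apply: eq_bigr => i _; rewrite mxE.
rewrite q; under eq_cvg do rewrite q.
apply: cvg_sumr => j; apply: cvgM => //; apply: cvg_sumr => i.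
by apply: cvgM => //; exact: cvg_cst.
Qed.

Lemma cvg_energy : (fun n => energy eps lam e h img (u n) C) @ \oo --> energy eps lam e h img V C.
Proof.
have c1 := cvg_fst_coord; have c2 := cvg_snd_coord.
apply: cvgB; last first.
  by apply: cvgD; (apply: cvgM; first exact: cvg_cst); exact: cvg_form.
apply: cvg_sumr => l; apply: cvgD.
  by apply: cvgD; (apply: cvgM; first exact: cvg_cst); exact: cvg_dwell.
have H1 := cvg_heaviside e_gt0 (c1 l); have H2 := cvg_heaviside e_gt0 (c2 l).
have cB (f : nat -> R) (g : R) : f @ \oo --> g -> (fun n => 1 - f n) @ \oo --> 1 - g.
  by move=> fg; apply: cvgB => //; exact: cvg_cst.
have k1 := cB _ _ H1; have k2 := cB _ _ H2.
rewrite /F; apply: cvgM; first exact: cvg_cst.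
apply: cvg_sumr => r.
by apply: cvgD; [apply: cvgD; [apply: cvgD|]|];
  (apply: cvgM => //; apply: cvgM => //; exact: cvg_cst).
Qed.

End Limits.

(** * Optimality of the average intensities *)

Section Average.
Variables (R : realType) (M1 M2 om : nat) (eps lam e h : R).
Variable img : 'I_(M2 * M1) -> 'I_om -> R.
Hypotheses (lam_gt0 : 0 < lam) (e_gt0 : 0 < e).

(** The decomposition of a weighted square deviation into variance and squared bias. If the total
    weight is zero, both sides vanish. *)
Lemma weighted_mean_le n (w x : 'I_n -> R) (c c' : R) : (forall l, 0 <= w l) ->
  (\sum_l w l != 0 -> c' = (\sum_l w l * x l) / \sum_l w l) ->
  \sum_l (x l - c') ^+ 2 * w l <= \sum_l (x l - c) ^+ 2 * w l.
Proof.
move=> w0 hc; have [s0|s0] := eqVneq (\sum_l w l) 0.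
  have wz l : w l = 0 by have /psumr_eq0P := s0; apply.
  by rewrite !big1 // => l _; rewrite wz mulr0.
have e1 : \sum_l w l * x l = c' * \sum_l w l by rewrite (hc s0) divfK.
have -> : \sum_l (x l - c) ^+ 2 * w l = \sum_l (x l - c') ^+ 2 * w l
    + (c' - c) ^+ 2 * \sum_l w l + 2 * (c' - c) * (\sum_l w l * x l - c' * \sum_l w l).
  rewrite !mulr_sumr -sumrB mulr_sumr -!big_split /=; apply: eq_bigr => l _; ring.
rewrite e1 subrr mulr0 addr0 lerDl mulr_ge0 ?sqr_ge0 //.
exact: sumr_ge0.
Qed.

Lemma average_energy (U : phases R M1 M2) (C C' : intensities R om) :
  is_average_intensity e img U C' ->
  energy eps lam e h img U C' <= energy eps lam e h img U C.
Proof.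
move=> hC; rewrite /energy lerD2r !big_split /= lerD2l.
have FE (X : intensities R om) : \sum_l F lam e (U.1 l 0) (U.2 l 0) (img l) X
   = lam * \sum_r (\sum_l (img l r - X 0 0 r) ^+ 2 * weight e 0 0 U l
     + \sum_l (img l r - X 0 1 r) ^+ 2 * weight e 0 1 U l
     + \sum_l (img l r - X 1 0 r) ^+ 2 * weight e 1 0 U l
     + \sum_l (img l r - X 1 1 r) ^+ 2 * weight e 1 1 U l).
  rewrite -mulr_sumr exchange_big /=; congr (_ * _); apply: eq_bigr => r _.
  rewrite -!big_split /=; apply: eq_bigr => l _.
  by rewrite /fidelity /weight /=; ring.
rewrite !FE ler_pM2l //; apply: ler_sum => r _.
have w0 a b l : 0 <= weight e a b U l.
  have /andP[? ?] := heaviside01 e_gt0 (U.1 l 0 - 2^-1).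
  have /andP[? ?] := heaviside01 e_gt0 (U.2 l 0 - 2^-1).
  by rewrite /weight; case: ifP; case: ifP => _ _; rewrite mulr_ge0 // subr_ge0.
by do 3?[apply: lerD]; apply: weighted_mean_le => // /hC.
Qed.

End Average.

(** * Invariant radii *)

Lemma radius_half (R : realType) (eps S : R) : 0 < eps -> 2 * eps^-1 <= S ->
  invariant_radius eps S 2^-1.
Proof.
rewrite -invr_gt0 /invariant_radius; move: eps^-1 => q q0 hS; split=> // x.
rewrite !ler_norml => /andP[x1 x2].
have h1 : 0 <= (S - 2 * q) * (2^-1 - x) by rewrite mulr_ge0 //; lra.
have h2 : 0 <= (S - 2 * q) * (x + 2^-1) by rewrite mulr_ge0 //; lra.
(* At [S = 2 q] the gap is [q * (1 - 3 x + 4 x ^ 3)], which has a double root at [x = 1 / 2]. *)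
have h3 : 0 <= q * ((2 * x - 1) ^+ 2 * (1 + x)).
  by rewrite mulr_ge0 ?(ltW q0) // mulr_ge0 ?sqr_ge0 //; lra.
have h4 : 0 <= q * ((2 * x + 1) ^+ 2 * (1 - x)).
  by rewrite mulr_ge0 ?(ltW q0) // mulr_ge0 ?sqr_ge0 //; lra.
apply/andP; split; rewrite -subr_ge0.
  rewrite (_ : _ - _ = (S - 2 * q) * (x + 2^-1) + q * ((2 * x + 1) ^+ 2 * (1 - x))).
    by rewrite addr_ge0.
  by field.
rewrite (_ : _ - _ = (S - 2 * q) * (2^-1 - x) + q * ((2 * x - 1) ^+ 2 * (1 + x))).
  by rewrite addr_ge0.
by field.
Qed.

(** Origin of the radius: when [S = 1 / eps] it must be at least the maximum of [2 x - 4 x ^ 3] on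
    the positive axis, [2 sqrt 6 / 9], and [49 / 90] is just above it. *)
Lemma cubic_ge0 (R : realFieldType) (y : R) : - (49 / 90) <= y ->
  0 <= 4 * y ^+ 3 - 2 * y + 49 / 90.
Proof.
move=> y1; have [y0|/ltW y0] := leP y 0.
  have y2 : 0 <= 2 - 4 * y ^+ 2.
    have : 0 <= (y + 49 / 90) * (49 / 90 - y) by rewrite mulr_ge0 //; lra.
    lra.
  have -> : 4 * y ^+ 3 - 2 * y + 49 / 90 = - y * (2 - 4 * y ^+ 2) + 49 / 90 by ring.
  by rewrite addr_ge0 ?mulr_ge0 ?oppr_ge0 //; lra.
(* The minimum on the positive axis is at [sqrt (1 / 6)], just below [a]. *)
have [a [a0 a2 a3]] : exists a : R, [/\ 0 <= a, 2 <= 12 * a ^+ 2 & 8 * a ^+ 3 <= 49 / 90].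
  by exists (89 / 218); split; lra.
rewrite (_ : _ + _ = (y - a) ^+ 2 * (4 * y + 8 * a) + (12 * a ^+ 2 - 2) * y
  + (49 / 90 - 8 * a ^+ 3)); last by ring.
have h1 : 0 <= 4 * y + 8 * a by lra.
apply: addr_ge0; [apply: addr_ge0|by rewrite subr_ge0].
  by rewrite mulr_ge0 ?sqr_ge0.
by rewrite mulr_ge0 ?subr_ge0.
Qed.

Lemma radius_large (R : realType) (eps S : R) : 0 < eps -> eps^-1 <= S ->
  invariant_radius eps S (49 / 90).
Proof.
rewrite -invr_gt0 /invariant_radius; move: eps^-1 => q q0 hS; split=> [|x].
  by lra.
rewrite !ler_norml => /andP[x1 x2].
have h1 : 0 <= (S - q) * (49 / 90 - x) by rewrite mulr_ge0 //; lra.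
have h2 : 0 <= (S - q) * (x + 49 / 90) by rewrite mulr_ge0 //; lra.
have h3 : 0 <= q * (4 * x ^+ 3 - 2 * x + 49 / 90) by rewrite mulr_ge0 ?(ltW q0) // cubic_ge0.
have h4 : 0 <= q * (4 * (- x) ^+ 3 - 2 * (- x) + 49 / 90).
  by rewrite mulr_ge0 ?(ltW q0) // cubic_ge0 // lerN2.
apply/andP; split; rewrite -subr_ge0.
  rewrite (_ : _ - _ = (S - q) * (x + 49 / 90) + q * (4 * (- x) ^+ 3 - 2 * (- x) + 49 / 90)).
    by rewrite addr_ge0.
  by ring.
rewrite (_ : _ - _ = (S - q) * (49 / 90 - x) + q * (4 * x ^+ 3 - 2 * x + 49 / 90)).
  by rewrite addr_ge0.
by ring.
Qed.

Lemma dwell'_lt0 (R : realType) (t : R) : t < 0 -> dwell' t < 0.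
Proof.
move=> t0; have : 0 < (- t) * (1 - 2 * t) * (1 - t) by rewrite !mulr_gt0 //; lra.
by rewrite /dwell'; lra.
Qed.

Lemma dwell'_gt0 (R : realType) (t : R) : 1 < t -> 0 < dwell' t.
Proof.
by move=> t1; rewrite /dwell' !mulr_gt0 //; lra.
Qed.

(** * Energy comparison at a steady state *)

Section Iteration.
Variables (R : realType) (M1 M2 om : nat) (eps lam e h S dt : R).
Variable img : 'I_(M2 * M1) -> 'I_om -> R.
Variable C : intensities R om.
Hypotheses (eps_gt0 : 0 < eps) (lam_gt0 : 0 < lam) (S_gt0 : 0 < S) (dt_gt0 : 0 < dt).
Hypotheses (e_gt0 : 0 < e) (e_le : e <= 6^-1).
Local Notation sg := (S - eps^-1).
Hypothesis sg_ge : om%:R * lam * pi / e ^+ 2 <= sg.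
Hypothesis img01 : forall l r, 0 <= img l r <= 1.
Hypothesis C01 : forall a b r, 0 <= C a b r <= 1.

Local Notation phases := (phases R M1 M2).
Local Notation D := (- (2 * eps) *: Dh M1 M2 h).
Local Notation E U := (energy eps lam e h img U C).
Local Notation N U := (nonlin eps lam e S img U C).
Local Notation etd1 U := (etd1_step eps lam e h S dt img C U).
Local Notation step s U := (scheme_step eps lam e h S dt img s C U).
Local Notation lyap k U := (lyapunov eps lam e h img C k U).
Local Notation inv b := (invariant_radius eps S b).
Implicit Types U V : phases.

Let sg_ge0 : 0 <= sg.
Proof.
have p0 := pi_gt0 R; apply: le_trans sg_ge.
by rewrite divr_ge0 ?sqr_ge0 // !mulr_ge0 ?(ltW lam_gt0) ?(ltW p0).
Qed.

Let q_gt0 : 0 < eps^-1. Proof. by rewrite invr_gt0. Qed.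

(** Three regimes: large [S] with radius 1/2; smaller [S] with strong damping, where the energy
    alone decreases; and weak damping, where the penalty enters with weight [eps^-1]. *)
Lemma scheme_lyapunov s : exists b k, [/\ inv b, 0 <= k &
  forall U, inbox b U -> lyap k (step s U) <= lyap k U /\
    (lyap k (step s U) = lyap k U -> etd1 U = U)].
Proof.
have l0 U : lyap 0 U = E U by rewrite /lyapunov mul0r addr0.
have m0 := damp1_gt0 dt_gt0 S_gt0.
have qS : eps^-1 <= S by rewrite -subr_ge0.
have decr := energy_decrease h eps_gt0 lam_gt0 S_gt0 dt_gt0 e_gt0 e_le sg_ge img01 C01 s.
have [S2|/ltW S2] := leP (2 * eps^-1) S.
  have hb := radius_half eps_gt0 S2; exists 2^-1, 0; split=> // U hU.
  rewrite !l0; apply: decr hb _ hU.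
  have -> : 6 * 2^-1 ^+ 2 - 3 / 2 = 0 :> R by field.
  by rewrite mulr0 pmulr_rgt0 //; lra.
have hb := radius_large eps_gt0 qS.
have [mq|/ltW mq] := leP (3 / 8 * eps^-1) (damp1 dt S).
  exists (49 / 90), 0; split=> // U hU.
  rewrite !l0; apply: decr hb _ hU.
  (* Here [6 (49 / 90) ^ 2 - 3 / 2 = 188 / 675] is below [9 / 32 = 3 / 4 * 3 / 8]. *)
  by have q0 := q_gt0; lra.
exists (49 / 90), eps^-1; split=> [//||U hU]; first exact: ltW.
exact: lyapunov_decrease.
Qed.

(** A fixed point of ETD1 has zero increment, hence zero residual. At an extremal pixel outside
    [0, 1] the force vanishes and [dwell'] has the sign that contradicts [generator_max]. *)
Lemma steady_unit_interval V : etd1 V = V ->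
  forall l, 0 <= V.1 l 0 <= 1 /\ 0 <= V.2 l 0 <= 1.
Proof.
move=> fV; have gD : generator D by apply: Dh_generator; apply: ltW.
have [m [P [ell fP]]] := generator_frame S gD.
have steady (v nu : 'cV[R]_(M2 * M1)) :
    v = mxfun (@phi0 R) (dt *: (D + S%:M)) *m v
      + dt *: (mxfun (@phi1 R) (dt *: (D + S%:M)) *m nu) ->
    forall l, \sum_k D l k * v k 0 = nu l 0 - S * v l 0.
  move=> ev l; have /eqP : nu - (D + S%:M) *m v = 0.
    apply: (hat_eq0 fP) => j; rewrite (etd1_residual fP S_gt0 dt_gt0 j ev).
    by rewrite subrr mulmx0 mxE mulr0.
  by rewrite subr_eq0 => /eqP ->; rewrite mulmxDl mul_scalar_mx !mxE; ring.
have unit_of (v f : 'cV[R]_(M2 * M1)) :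
    (forall l, \sum_k D l k * v k 0 = - (eps^-1 * dwell' (v l 0) + f l 0)) ->
    (forall l, 6^-1 <= `|v l 0 - 2^-1| -> f l 0 = 0) ->
    forall l, 0 <= v l 0 <= 1.
  move=> hv f0 l0.
  have q0 := q_gt0.
  pose hi := [arg max_(i > l0) (v i 0 : R)]%O; pose lo := [arg min_(i < l0) (v i 0 : R)]%O.
  have hiP k : v k 0 <= v hi 0 by rewrite /hi; case: arg_maxP => //= i _; apply.
  have loP k : v lo 0 <= v k 0 by rewrite /lo; case: arg_minP => //= i _; apply.
  apply/andP; split.
    apply: le_trans (loP l0); rewrite leNgt; apply/negP => v0.
    have := @generator_max R _ D (fun k => - v k 0) lo gD.
    have hN k : - v k 0 <= - v lo 0 by rewrite lerN2.
    move=> /(_ hN); rewrite (eq_bigr (fun k => - (D lo k * v k 0))); last first.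
      by move=> k _; rewrite mulrN.
    rewrite sumrN hv opprK f0 ?addr0; last by rewrite ler0_norm; lra.
    rewrite pmulr_rge0 // => w0.
    by have := dwell'_lt0 v0; rewrite ltNge w0.
  apply: le_trans (hiP l0) _; rewrite leNgt; apply/negP => v1.
  have := @generator_max R _ D (fun k => v k 0) hi gD hiP.
  rewrite hv f0 ?addr0; last by rewrite ger0_norm; lra.
  rewrite oppr_ge0 pmulr_rle0 // => w0.
  by have := dwell'_gt0 v1; rewrite ltNge w0.
have e1 : V.1 = mxfun (@phi0 R) (dt *: (D + S%:M)) *m V.1
      + dt *: (mxfun (@phi1 R) (dt *: (D + S%:M)) *m (N V).1) by rewrite -[in LHS]fV.
have e2 : V.2 = mxfun (@phi0 R) (dt *: (D + S%:M)) *m V.2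
      + dt *: (mxfun (@phi1 R) (dt *: (D + S%:M)) *m (N V).2) by rewrite -[in LHS]fV.
move=> l; split.
  apply: (unit_of V.1 (\col_k f1 lam e (V.1 k 0) (V.2 k 0) (img k) C)) => k.
    by rewrite (steady _ _ e1) /= !mxE; ring.
  by rewrite mxE; apply: f1_eq0.
apply: (unit_of V.2 (\col_k f2 lam e (V.1 k 0) (V.2 k 0) (img k) C)) => k.
  by rewrite (steady _ _ e2) /= !mxE; ring.
by rewrite mxE; apply: f2_eq0.
Qed.

Lemma steady_state_energy s U V :
  (forall l, 0 <= U.1 l 0 <= 1 /\ 0 <= U.2 l 0 <= 1) ->
  reaches_steady_state (scheme_step eps lam e h S dt img s C) U V ->
  (forall l, 0 <= V.1 l 0 <= 1 /\ 0 <= V.2 l 0 <= 1) /\ E V <= E U.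
Proof.
move=> U01 [fV cV]; have [b [k [hb k0 dec]]] := scheme_lyapunov s.
have b2 : 2^-1 <= b by case: hb.
have hU : inbox b U.
  move=> l; have [/andP[? ?] /andP[? ?]] := U01 l.
  by rewrite !ler_norml; split; apply/andP; split; lra.
pose u n := iter n (scheme_step eps lam e h S dt img s C) U.
have hu n : inbox b (u n).
  elim: n => [//|n IH]; rewrite /u iterS; exact: step_inbox.
have lu n : lyap k (u n) <= lyap k U.
  by elim: n => [//|n IH]; apply: le_trans IH; rewrite /u iterS; apply: (dec _ (hu n)).1.
have c1 := cvg_fst_coord cV; have c2 := cvg_snd_coord cV.
have hV : inbox b V.
  have bd (a : nat -> R) (x : R) : (forall n, `|a n - 2^-1| <= b) -> a @ \oo --> x ->
      `|x - 2^-1| <= b.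
    move=> ha ax; have ax' : (fun n => `|a n - 2^-1|) @ \oo --> `|x - 2^-1|.
      by apply: cvg_norm; apply: cvgB => //; exact: cvg_cst.
    by apply: (cvgr_to_le ax'); near=> n; apply: ha.
  by move=> l; split; [apply: (bd _ _ _ (c1 l))|apply: (bd _ _ _ (c2 l))] => n; have [] := hu n l.
have lV : lyap k V <= lyap k U.
  have cl : (fun n => lyap k (u n)) @ \oo --> lyap k V.
    apply: cvgD; first exact: cvg_energy.
    apply: cvgM; first exact: cvg_cst.
    apply: cvg_sumr => l; apply: cvgD; apply: cvg_psi; apply: cvgB; try exact: cvg_cst.
      exact: c1.
    exact: c2.
  by apply: (cvgr_to_le cl); near=> n; apply: lu.
(* The limit is fixed by the scheme, so its Lyapunov value does not change, and the equality case
   applies. *)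
have V01 := steady_unit_interval ((dec V hV).2 (congr1 _ fV)).
split=> //; have EV : E V <= lyap k V.
  rewrite /lyapunov lerDl mulr_ge0 // sumr_ge0 // => l _.
  by rewrite addr_ge0 // psi_ge0.
(* The initial phases lie in [0, 1], so their penalty is zero. *)
apply: le_trans EV (le_trans lV _).
rewrite /lyapunov big1 ?mulr0 ?addr0 // => l _; rewrite /psi.
have [/andP[? ?] /andP[? ?]] := U01 l.
by rewrite !overshoot0 ?expr0n /= ?addr0 ?mulr0 ?addr0 //; lra.
Unshelve. all: by end_near. Qed.

End Iteration.

Theorem theorem3p4 (R : realType) (M1 M2 om p : nat)
    (eps lam eps1 h S dt : R) (img : 'I_(M2 * M1) -> 'I_om -> R)
    (s : scheme) (U : nat -> phases R M1 M2) (C : nat -> intensities R om) :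
  0 < eps -> 0 < lam -> 0 < h -> 0 < S -> 0 < dt ->
  odd p -> eps1 = (2 * p%:R)^-1 -> eps1 < 2^-1 ->
  (forall l r, 0 <= img l r <= 1) ->
  (forall k a b r, 0 <= C k a b r <= 1) ->
  (forall l, 0 <= (U 0%N).1 l 0 <= 1 /\ 0 <= (U 0%N).2 l 0 <= 1) ->
  adm_iteration eps lam eps1 h S dt img s U C ->
  let gamma := 2 / eps + 2 * om%:R * lam * pi / eps1 ^+ 2 in
  gamma / 2 <= S ->
  forall k, energy eps lam eps1 h img (U k.+1) (C k.+1)
            <= energy eps lam eps1 h img (U k) (C k).
Proof.
move=> eps0 lam0 h0 S0 dt0 podd eps1E eps1_lt img01 C01 U01 adm gamma gS.
(* The bound [eps1 < 1 / 2] rules out [p = 1], so the force acts only within 1/6 of 1/2. *)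
have p3 : (3 <= p)%N.
  case: p podd eps1E eps1_lt => [|[|[|p]]] //= _ ->.
  by rewrite mulr1 ltxx.
have p3R : 3 <= p%:R :> R by rewrite (ler_nat R 3 p).
have e0 : 0 < eps1 by rewrite eps1E invr_gt0 mulr_gt0 //; lra.
have e6 : eps1 <= 6^-1 by rewrite eps1E lef_pV2 ?posrE ?mulr_gt0 //; lra.
(* Of [gamma / 2], the double well takes [eps^-1]; the rest is for the fidelity term. *)
have sg : om%:R * lam * pi / eps1 ^+ 2 <= S - eps^-1.
  rewrite -subr_ge0; apply: le_trans (_ : 0 <= S - gamma / 2) _; first by rewrite subr_ge0.
  by rewrite /gamma le_eqVlt; apply/orP; left; apply/eqP; move: pi => q; field;
    rewrite !gt_eqF.
(* Each steady state returns to [0, 1], so the next outer iteration starts without penalty. *)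
have U01' k : forall l, 0 <= (U k).1 l 0 <= 1 /\ 0 <= (U k).2 l 0 <= 1.
  elim: k => [//|k IH]; have [st _] := adm k.
  exact: (steady_state_energy eps0 lam0 S0 dt0 e0 e6 sg img01 (C01 k) IH st).1.
move=> k; have [st av] := adm k.
apply: le_trans (average_energy eps h lam0 e0 (C k) av) _.
exact: (steady_state_energy eps0 lam0 S0 dt0 e0 e6 sg img01 (C01 k) (U01' k) st).2.
Qed.
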